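(* Let $G$ be a connected $3$-regular multigraph with $n$ vertices and $m\ge 6$ edges, possibly with loops, embedded on a sphere $\Sigma$. Then there exists a $\frac{2}{3}$-edge-balanced noose with respect to $G$ of length at most $\sqrt{4.5\,n}$.
   Context: A loop contributes $2$ to the degree of its vertex. A noose with respect to an embedded connected multigraph $G$ is a directed closed curve (homeomorphic image of a circle, with a chosen direction) on $\Sigma$ that intersects the embedding of $G$ only in vertices of $G$, visits at least one vertex, and visits every face of $G$ at most once. Its length is the number of vertices of $G$ it passes through. The curve splits $\Sigma$ into two open disks: the enclosed area (to its right) and the excluded area (to its left). The enclosed subgraph $\mathrm{enc}(\gamma,G)$ consists of all vertices and edges of $G$ embedded in the union of the enclosed area and $\gamma$; the excluded subgraph $\mathrm{exc}(\gamma,G)$ is defined analogously. A noose $\gamma$ is $\alpha$-edge-balanced if $|E(\mathrm{enc}(\gamma,G))|\le\alpha|E(G)|$ and $|E(\mathrm{exc}(\gamma,G))|\le\alpha|E(G)|$. *)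

(* Defs.v *)
(* Embedded multigraphs on the sphere are represented by
   combinatorial maps (rotation systems). *)
From HB Require Import structures.
From mathcomp Require Import all_boot all_order all_fingroup.
Set Implicit Arguments. Unset Strict Implicit. Unset Printing Implicit Defensive.

Section Maps.
Variable D : finType.  (* darts = half-edges *)

(* A combinatorial map: [alpha] pairs the two darts of each edge (a loop has
   two darts at the same vertex), [sigma] is the cyclic rotation of darts
   around each vertex.  Vertices = sigma-orbits, edges = alpha-orbits,
   faces = orbits of the face permutation  phi = sigma o alpha
   (in mathcomp, (alpha * sigma) x = sigma (alpha x)).  The corner indexed by
   a dart e is the angle between (sigma^-1 e) and e at the vertex of e; it
   lies in the face (porbit phi e). *)
Definition face_perm (alpha sigma : {perm D}) : {perm D} := (alpha * sigma)%g.

Definition is_map (alpha sigma : {perm D}) : Prop :=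
  (forall d, alpha (alpha d) = d /\ alpha d != d) /\
  (forall d e, connect (fun x y => (y == alpha x) || (y == sigma x)) d e).

Definition nvertices (sigma : {perm D}) : nat := #|porbits sigma|.
Definition nedges (alpha : {perm D}) : nat := #|porbits alpha|.
Definition nfaces (alpha sigma : {perm D}) : nat := #|porbits (face_perm alpha sigma)|.

(* connected map embedded (necessarily cellularly) on the sphere: Euler
   characteristic 2 *)
Definition spherical (alpha sigma : {perm D}) : Prop :=
  is_map alpha sigma /\
  (nvertices sigma + nfaces alpha sigma = nedges alpha + 2)%N.

Definition cubic (sigma : {perm D}) : Prop := forall d, #|porbit sigma d| = 3.

(* Darts at the vertex of [a] met when rotating (along sigma) from the corner
   indexed by [a] to the corner indexed by [b]: a, sigma a, ..., sigma^-1 b. *)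
Definition arc (sigma : {perm D}) (a b : D) : seq D :=
  take (index b (fingraph.orbit sigma a)) (fingraph.orbit sigma a).

(* A noose of length k: at its i-th vertex (the vertex of a i, = vertex of b i)
   it enters through corner (a i) and leaves through corner (b i); it then
   crosses the face of corner (b i), which must be the face of corner
   a (i+1 mod k).  Vertices are pairwise distinct (simple curve) and the
   traversed faces are pairwise distinct (each face visited at most once). *)
Definition is_noose (alpha sigma : {perm D}) (k : nat)
    (a b : 'I_k -> D) : Prop :=
  (0 < k)%N /\
  (forall i, b i \in porbit sigma (a i)) /\
  (forall i j, porbit sigma (a i) = porbit sigma (a j) -> i = j) /\
  (forall i, porbit (face_perm alpha sigma) (b i) =
             porbit (face_perm alpha sigma) (a (ordS i))) /\
  (forall i j, porbit (face_perm alpha sigma) (b i) =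
               porbit (face_perm alpha sigma) (b j) -> i = j).

(* [S] is the set of darts of the edges lying on the enclosed side of the
   noose: it is a union of edges, at each noose vertex it consists exactly of
   the darts swept from the entry corner to the exit corner, and at every
   other vertex (which lies inside one of the two open disks) all incident
   darts lie on the same side.  For a connected map such an S is unique. *)
Definition enclosed_darts (alpha sigma : {perm D}) (k : nat)
    (a b : 'I_k -> D) (S : {set D}) : Prop :=
  (forall d, (d \in S) = (alpha d \in S)) /\
  (forall i x, x \in porbit sigma (a i) -> (x \in S) = (x \in arc sigma (a i) (b i))) /\
  (forall x, (forall i, x \notin porbit sigma (a i)) -> (x \in S) = (sigma x \in S)).

Definition edges_in (alpha : {perm D}) (S : {set D}) : nat :=
  #|[set porbit alpha d | d in S]|.

Definition two_thirds_balanced (alpha : {perm D}) (S : {set D}) : Prop :=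
  (3 * edges_in alpha S <= 2 * nedges alpha)%N /\
  (3 * edges_in alpha (~: S) <= 2 * nedges alpha)%N.

End Maps.

(* Main.v *)
(* A bond of the cubic graph is an edge cut delta(A) with A and its complement
   connected; in the dual it is a simple closed curve, and pushing that curve
   onto the end points of the cut edges in A gives a noose.  Let L be maximal
   with 2 L^2 <= 9 n and suppose that no bond with at most L edges is balanced.
   Following Alon, Seymour and Thomas, take a smallest A meeting at least a third
   of the edges whose bond has at most L edges.  By minimality the bond has
   exactly L edges, and two faces f_i, f_j of its boundary cycle cannot be joined
   inside A by a dual path shorter than both boundary arcs.  Explore the faces
   inside A in breadth-first order from f_0: layer r contains a dual path from f_r to
   f_(-r), hence at least min(2r, L - 2r) + 1 faces.  Summing over r <= L/2,
   9 (F - 2) >= (L + 1)^2, which contradicts F = n/2 + 2 and the choice of L.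
   The Jordan curve theorem enters as H^1(S^2; F_2) = 0, which follows from
   Euler's formula by rank-nullity. *)
Require Import Defs.
From mathcomp Require Import all_boot all_order all_fingroup all_algebra.
From mathcomp Require Import zify.
Set Implicit Arguments. Unset Strict Implicit. Unset Printing Implicit Defensive.
Import GRing.Theory.

(** * Jordan curves *)

(** Only two curves are made explicit, the boundary cycle of a bond and the noose; all others are
    ['F_2]-chains of dual edges. A chain joining two faces of the boundary cycle, added to a
    boundary arc, is even on every face, so [jordan] turns it into the edge cut of a vertex set, and
    the minimality of [A] speaks about such sets. Sizes are counted in darts: [#|A| + cut A (~: A)]
    is compared with [#|D|] and [2 * #|D|], and a dual edge of a chain counts twice. Degree three
    enters three times: any two faces at a vertex are adjacent, which makes the layers connected;
    deleting a boundary vertex lengthens the boundary by at most one; and a noose vertex carries at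
    most two cut edges. The bound on [m] supplies [12 <= #|D|] and [4 <= L]. *)

Section Incidence.
Variable D : finType.
Implicit Types (s t : {perm D}) (d : D).

Lemma porbit_in_porbits s d : porbit s d \in porbits s.
Proof. exact: imset_f. Qed.

Definition orbit_idx s d : 'I_#|porbits s| :=
  enum_rank_in (porbit_in_porbits s d) (porbit s d).

Lemma enum_val_orbit_idx s d : enum_val (orbit_idx s d) = porbit s d.
Proof. exact/enum_rankK_in/porbit_in_porbits. Qed.

Lemma mem_orbit_idx s d (i : 'I_#|porbits s|) :
  (d \in enum_val i) = (i == orbit_idx s d).
Proof.
have /imsetP [x _ ex] := enum_valP i.
rewrite ex -eq_porbit_mem -ex -(inj_eq enum_val_inj) enum_val_orbit_idx.
by rewrite eq_sym.
Qed.

Lemma orbit_idx_perm s d : orbit_idx s (s d) = orbit_idx s d.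
Proof.
by apply: enum_val_inj; rewrite !enum_val_orbit_idx (porbit_perm s 1 d).
Qed.

Local Open Scope ring_scope.

(** These are the boundary maps of the cellular chain complex: modulo 2 a loop, meeting its vertex
    in two darts, gets the entry 0. *)
Definition incidence s t : 'M['F_2]_(#|porbits s|, #|porbits t|) :=
  \matrix_(i, j) #|enum_val i :&: enum_val j|%:R.

Lemma trmx_incidence s t : (incidence s t)^T = incidence t s.
Proof. by apply/matrixP => i j; rewrite !mxE setIC. Qed.

Lemma card_setI_sum (A B : {set D}) :
  #|A :&: B|%:R = \sum_(d in B) (d \in A)%:R :> 'F_2.
Proof.
rewrite -sum1_card natr_sum [RHS](bigID (mem A)) /=.
rewrite [X in _ = _ + X]big1 ?addr0; last by move=> d /andP [_ /negPf ->].
by apply: eq_big => d; [rewrite inE andbC | rewrite inE => /andP [->]].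
Qed.

Lemma mul_incidence s t (y : 'rV_#|porbits s|) j :
  (y *m incidence s t) 0 j = \sum_(d in enum_val j) y 0 (orbit_idx s d).
Proof.
rewrite mxE; under eq_bigr do rewrite mxE card_setI_sum big_distrr /=.
rewrite exchange_big /=; apply: eq_bigr => d _.
rewrite (bigD1 (orbit_idx s d)) //= mem_orbit_idx eqxx mulr1.
rewrite big1 ?addr0 // => i /negPf ni.
by rewrite mem_orbit_idx ni mulr0.
Qed.

End Incidence.

Section SphericalMap.
Variable D : finType.
Variables alpha sigma : {perm D}.
Hypothesis alphaK : forall d, alpha (alpha d) = d.
Hypothesis alphaN : forall d, alpha d != d.
Hypothesis map_connected : forall d e,
  connect (fun x y => (y == alpha x) || (y == sigma x)) d e.
Hypothesis euler :
  (nvertices sigma + nfaces alpha sigma = nedges alpha + 2)%N.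
Implicit Types (A B C K Q R : {set D}) (d e u v x y : D).

Local Notation phi := (face_perm alpha sigma).

Lemma face_permE d : phi d = sigma (alpha d).
Proof. by rewrite permM. Qed.

Lemma porbit_alpha d : porbit alpha d = [set d; alpha d].
Proof.
apply/setP => x; rewrite !inE; apply/porbitP/idP => [[i ->]|].
  rewrite permX; elim: i => [|i /orP [] /eqP e]; first by rewrite eqxx.
    by rewrite iterS e eqxx orbT.
  by rewrite iterS e alphaK eqxx.
by case/orP => /eqP ->; [exists 0%N; rewrite expg0 perm1 | exists 1%N].
Qed.

Lemma big_porbit_alpha (T : Type) (idx : T) (op : Monoid.com_law idx) F d :
  \big[op/idx]_(x in porbit alpha d) F x = op (F d) (F (alpha d)).
Proof.
rewrite porbit_alpha big_setU1 ?big_set1 //.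
by rewrite inE eq_sym alphaN.
Qed.

Lemma invariant_constant (T : Type) (f : D -> T) :
  (forall d, f (alpha d) = f d) -> (forall d, f (sigma d) = f d) ->
  forall d e, f d = f e.
Proof.
move=> fa fs d e; have /connectP [p] := map_connected d e.
elim: p d => [|x p IH] d /= => [_ -> //|/andP [dx xp] ee].
by rewrite -(IH x) //; case/orP: dx => /eqP ->.
Qed.

Section Cohomology.
Local Open Scope ring_scope.

Lemma F2_eq (a b : 'F_2) : a + b = 0 -> a = b.
Proof. by move/eqP; rewrite addr_eq0 oppr_pchar2 ?pchar_Fp // => /eqP. Qed.

(** A vector in the left kernel agrees on the two ends of every edge, so connectivity makes it
    constant and the kernel has dimension at most 1. *)
Lemma rank_incidence (s : {perm D}) :
  (forall f : D -> 'F_2, (forall d, f (alpha d) = f d) ->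
     (forall d, f (s d) = f d) -> forall d e, f d = f e) ->
  (#|porbits s| <= \rank (incidence s alpha) + 1)%N.
Proof.
move=> conn.
have : (kermx (incidence s alpha) <= (const_mx 1 : 'rV_#|porbits s|))%MS.
  apply/rV_subP => y /sub_kermxP y0.
  have ya d : y 0 (orbit_idx s (alpha d)) = y 0 (orbit_idx s d).
    apply/esym/F2_eq; rewrite -(big_porbit_alpha _ (fun d => y 0 (orbit_idx s d))).
    by rewrite -(enum_val_orbit_idx alpha) -mul_incidence y0 mxE.
  have yc := conn _ ya (fun d => congr1 _ (orbit_idx_perm s d)).
  apply/sub_rVP; case: (pickP (mem [set: D])) => [d _ | no].
    exists (y 0 (orbit_idx s d)); apply/rowP => i; rewrite !mxE mulr1.
    have /imsetP [e _ ei] := enum_valP i.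
    have -> : i = orbit_idx s e by apply: enum_val_inj; rewrite enum_val_orbit_idx.
    exact: yc.
  exists 0; apply/rowP => i; have /imsetP [e _ _] := enum_valP i.
  by have := no e; rewrite /= inE.
move/mxrankS; rewrite mxrank_ker => /leq_trans /(_ (rank_leq_row _)).
by rewrite leq_subLR.
Qed.

(** Since [alpha d] and [phi d] share a vertex, shifting the sum over a face along [phi] makes the
    two ends of its edges cancel. *)
Lemma incidence_boundary : incidence sigma alpha *m incidence alpha phi = 0.
Proof.
apply/matrixP => i j; rewrite [RHS]mxE.
have -> : (incidence sigma alpha *m incidence alpha phi) i j =
   (row i (incidence sigma alpha) *m incidence alpha phi) 0 j.
  by rewrite -row_mul [RHS]mxE.
rewrite mul_incidence; set v := enum_val i.
have vs d : (sigma d \in v) = (d \in v) by rewrite !mem_orbit_idx orbit_idx_perm.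
under eq_bigr do rewrite !mxE card_setI_sum enum_val_orbit_idx big_porbit_alpha
  -(vs (alpha _)) -face_permE.
rewrite big_split /=.
have jphi d : (phi d \in enum_val j) = (d \in enum_val j).
  by rewrite !mem_orbit_idx orbit_idx_perm.
rewrite [X in X + _](reindex_inj (@perm_inj _ phi)) /=.
under eq_bigl do rewrite jphi.
by rewrite addrr_pchar2 ?pchar_Fp.
Qed.

Lemma rank_vertices : (#|porbits sigma| <= \rank (incidence sigma alpha) + 1)%N.
Proof. exact/rank_incidence/invariant_constant. Qed.

Lemma rank_faces : (#|porbits phi| <= \rank (incidence alpha phi) + 1)%N.
Proof.
rewrite -mxrank_tr trmx_incidence; apply: rank_incidence => f fa fp.
by apply: invariant_constant => // d; rewrite -{1}(alphaK d) -face_permE fp.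
Qed.

Definition parity Q A : bool := \big[addb/false]_(d in A) (d \in Q).

Lemma natF2_addb (a b : bool) : (a (+) b)%:R = a%:R + b%:R :> 'F_2.
Proof. by case: a; case: b => //=; apply/val_inj. Qed.

Lemma natF2_parity Q A : (parity Q A)%:R = \sum_(d in A) (d \in Q)%:R :> 'F_2.
Proof. exact: (big_morph (fun b : bool => b%:R) natF2_addb). Qed.

(* Cocycles (even on every face) are coboundaries: both spaces have dimension
   V - 1. *)
Lemma jordan Q :
  (forall d, (alpha d \in Q) = (d \in Q)) ->
  (forall d, parity Q (porbit phi d) = false) ->
  exists C, (forall d, (sigma d \in C) = (d \in C)) /\
            (forall d, (d \in Q) = (d \in C) (+) (alpha d \in C)).
Proof.
move=> Qa Qeven.
pose x : 'rV['F_2]_#|porbits alpha| := \row_(j < #|porbits alpha|) (enum_val j \subset Q)%:R.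
have xE d : x 0 (orbit_idx alpha d) = (d \in Q)%:R.
  rewrite mxE enum_val_orbit_idx porbit_alpha subUset !sub1set Qa.
  by rewrite andbb.
have xker : (x <= kermx (incidence alpha phi))%MS.
  apply/sub_kermxP/rowP => j; rewrite mul_incidence mxE.
  have /imsetP [d _ ->] := enum_valP j.
  by under eq_bigr do rewrite xE; rewrite -natF2_parity Qeven.
have sub : (incidence sigma alpha <= kermx (incidence alpha phi))%MS.
  exact/sub_kermxP/incidence_boundary.
have /eqmxP eqm : (incidence sigma alpha == kermx (incidence alpha phi))%MS.
  have [_ <-] := mxrank_leqif_eq sub; rewrite eqn_leq mxrankS //=.
  rewrite mxrank_ker; have := rank_vertices; have := rank_faces.
  move: euler; rewrite /nvertices /nfaces /nedges leq_subLR => e le1 le0.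
  rewrite -(leq_add2r 2) -e (leq_trans (leq_add le0 le1)) //.
  by rewrite addnACA (addnC (\rank (incidence sigma alpha))).
move: xker; rewrite -eqm => /submxP [y xy].
exists [set d | y 0 (orbit_idx sigma d) == 1].
split=> d; rewrite !inE ?orbit_idx_perm //.
have F2 (a : 'F_2) : a = (a == 1)%:R by case: a => [[|[|]]] //= i; apply/val_inj.
have := xE d; rewrite xy mul_incidence enum_val_orbit_idx big_porbit_alpha /=.
rewrite [y 0 _ in LHS]F2 [y 0 (orbit_idx _ (alpha d)) in LHS]F2 -natF2_addb.
by case: (_ (+) _); case: (d \in Q).
Qed.

End Cohomology.

(** * Cuts and bonds *)

(* Sets of vertices are represented by the sets of all their darts. *)
Definition vset A := [forall d, (sigma d \in A) == (d \in A)].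

(** Counts darts on the side of [A], which are edges when [A] and [B] are disjoint. *)
Definition cut A B := #|[set d in A | alpha d \in B]|.

(** Connectivity through vertex subsets that no edge leaves inside [A], the form in which the output
    of [jordan] can be used; the empty set counts as connected. *)
Definition conn A :=
  [forall K : {set D}, vset K && (K \subset A) && (cut K (A :\: K) == 0) ==>
     (K == set0) || (K == A)].

Lemma vsetP A : reflect (forall d, (sigma d \in A) = (d \in A)) (vset A).
Proof. exact/'forall_eqP. Qed.

Lemma connP A :
  reflect (forall K, vset K -> K \subset A -> cut K (A :\: K) = 0 ->
             K = set0 \/ K = A) (conn A).
Proof.
apply: (iffP forallP) => [H K vK sK cK | H K].
  by have := H K; rewrite vK sK cK /= => /orP [] /eqP ->; [left | right].
apply/implyP => /andP [/andP [vK sK] /eqP cK].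
by apply/orP; case: (H K vK sK cK) => ->; [left | right].
Qed.

Lemma vsetU A B : vset A -> vset B -> vset (A :|: B).
Proof. by move=> /vsetP a /vsetP b; apply/vsetP => d; rewrite !inE a b. Qed.

Lemma vsetI A B : vset A -> vset B -> vset (A :&: B).
Proof. by move=> /vsetP a /vsetP b; apply/vsetP => d; rewrite !inE a b. Qed.

Lemma vsetD A B : vset A -> vset B -> vset (A :\: B).
Proof. by move=> /vsetP a /vsetP b; apply/vsetP => d; rewrite !inE a b. Qed.

Lemma vsetC A : vset A -> vset (~: A).
Proof. by move=> /vsetP a; apply/vsetP => d; rewrite !inE a. Qed.

Lemma vset0 : vset set0.
Proof. by apply/vsetP => d; rewrite !inE. Qed.

Lemma vsetT : vset setT.
Proof. by apply/vsetP => d; rewrite !inE. Qed.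

Lemma vset_porbit d : vset (porbit sigma d).
Proof.
by apply/vsetP => x; rewrite porbit_sym -eq_porbit_mem (porbit_perm sigma 1)
  eq_porbit_mem porbit_sym.
Qed.

Lemma cutC A B : cut A B = cut B A.
Proof.
rewrite /cut -(card_imset _ (@perm_inj _ alpha)); apply: eq_card => d.
apply/imsetP/idP => [[x] | ]; rewrite !inE.
  by move=> /andP [xA xB] ->; rewrite alphaK xA xB.
by move=> /andP [dB dA]; exists (alpha d); rewrite ?inE alphaK ?dB ?dA.
Qed.

Lemma cutUl A A' B : [disjoint A & A'] -> cut (A :|: A') B = cut A B + cut A' B.
Proof.
move=> dis; rewrite /cut -cardsUI [X in _ = _ + #|pred_of_set X|](_ : _ = set0).
  by rewrite cards0 addn0; apply: eq_card => d; rewrite !inE andb_orl.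
apply/setP => d; rewrite !inE; case dA : (d \in A) => //=.
by rewrite (disjointFr dis dA) andbF.
Qed.

Lemma cutUr A B B' : [disjoint B & B'] -> cut A (B :|: B') = cut A B + cut A B'.
Proof. by move=> dis; rewrite cutC cutUl // !(cutC A). Qed.

Lemma cut_gt0P A B : reflect (exists2 d, d \in A & alpha d \in B) (0 < cut A B).
Proof.
apply: (iffP card_gt0P) => [[d]|[d dA dB]]; first by rewrite inE => /andP []; exists d.
by exists d; rewrite inE dA.
Qed.

Lemma cut_eq0P A B : reflect (forall d, d \in A -> alpha d \notin B) (cut A B == 0).
Proof.
apply: (iffP idP) => [/eqP c0 d dA | H].
  by apply/negP => dB; have /cut_gt0P : exists2 d, d \in A & alpha d \in B; [exists d | rewrite c0].
by rewrite eqn0Ngt; apply/cut_gt0P => -[d /H /negPf ->].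
Qed.

Lemma conn0 : conn set0.
Proof. by apply/connP => K _; rewrite subset0 => /eqP ->; left. Qed.

Lemma connT : conn setT.
Proof.
apply/connP => K /vsetP vK _ /eqP /cut_eq0P cK.
have inv d : (alpha d \in K) = (d \in K).
  apply/idP/idP => [aK | dK]; last by have := cK _ dK; rewrite !inE andbT negbK.
  by have := cK _ aK; rewrite !inE andbT negbK alphaK.
have c := invariant_constant inv vK.
case: (set_0Vmem K) => [-> | [d dK]]; first by left.
by right; apply/setP => e; rewrite inE -dK; apply: c.
Qed.

Lemma connU A B : vset A -> vset B -> conn A -> conn B -> 0 < cut A B ->
  conn (A :|: B).
Proof.
move=> vA vB /connP cA /connP cB /cut_gt0P [d dA dB].
apply/connP => K vK sK /eqP /cut_eq0P cK.
have piece E : vset E -> E \subset A :|: B -> cut (K :&: E) (E :\: (K :&: E)) = 0.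
  move=> vE /subsetP sE; apply/eqP/cut_eq0P => x; rewrite !inE => /andP [xK xE].
  apply/negP => /andP [+ yE]; rewrite yE andbT => nK.
  by have := cK x xK; have := sE _ yE; rewrite !inE => ->; rewrite nK.
have [KA | KA] := cA _ (vsetI vK vA) (subsetIr _ _) (piece _ vA (subsetUl _ _));
have [KB | KB] := cB _ (vsetI vK vB) (subsetIr _ _) (piece _ vB (subsetUr _ _)).
- by left; rewrite -(setIidPl sK) setIUr KA KB setU0.
- have : alpha d \in K :&: B by rewrite KB.
  rewrite inE => /andP [aK _]; have := cK _ aK.
  rewrite alphaK !inE dA /= andbT negbK => dK.
  by have : d \in K :&: A; [rewrite inE dK dA | rewrite KA inE].
- have : d \in K :&: A by rewrite KA.
  rewrite inE => /andP [dK _]; have := cK _ dK.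
  rewrite !inE dB orbT andbT negbK => aK.
  by have : alpha d \in K :&: B; [rewrite inE aK dB | rewrite KB inE].
- by right; rewrite -[LHS](setIidPl sK) setIUr KA KB.
Qed.

Lemma disjoint_setD A A1 : [disjoint A1 & A :\: A1].
Proof.
rewrite disjoint_sym disjoints_subset; apply/subsetP => d.
by rewrite !inE => /andP [].
Qed.

Definition bond A := [&& vset A, conn A & conn (~: A)].

Lemma cut_splitC A A1 B : A1 \subset A -> B = ~: A ->
  cut A1 (~: A1) = cut A1 (A :\: A1) + cut A1 B.
Proof.
move=> sA ->; rewrite -cutUr; last first.
  by rewrite disjoints_subset; apply/subsetP => d; rewrite !inE negbK => /andP [].
congr cut; apply/setP => d; rewrite !inE.
by case dA1: (d \in A1); case dA: (d \in A) => //; rewrite (subsetP sA _ dA1) in dA.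
Qed.

Lemma setDDK A A1 : A1 \subset A -> A :\: (A :\: A1) = A1.
Proof. by move=> sA; rewrite setDDr setDv set0U; apply/setIidPr. Qed.

Lemma cutDl A A1 B : A1 \subset A -> cut A B = cut A1 B + cut (A :\: A1) B.
Proof. by move=> sA; rewrite -cutUl ?disjoint_setD // -{1}(setID A A1) (setIidPr sA). Qed.

Lemma cutDr A A1 B : A1 \subset A -> cut B A = cut B A1 + cut B (A :\: A1).
Proof. by move=> sA; rewrite cutC (cutDl _ sA) !(cutC _ B). Qed.

(* The number #|A| + cut A (~: A) is twice the number of edges meeting A. *)
Section Tight.
Variables (L : nat) (A : {set D}).
Hypothesis bondA : bond A.
Hypothesis small : forall K, bond K -> K \proper A -> cut K (~: K) <= L ->
  3 * (#|K| + cut K (~: K)) < #|D|.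
Hypothesis heavy : 2 * #|D| < 3 * (#|A| + cut A (~: A)).
Hypothesis shortA : cut A (~: A) <= L.
Local Notation B := (~: A).

Let vA : vset A. Proof. by case/and3P: bondA. Qed.
Let cA : conn A. Proof. by case/and3P: bondA. Qed.
Let cB : conn B. Proof. by case/and3P: bondA. Qed.

Definition loose A1 :=
  cut A1 (A :\: A1) < minn (cut A1 B) (cut (A :\: A1) B).

Lemma looseC A1 : A1 \subset A -> loose (A :\: A1) = loose A1.
Proof. by move=> sA; rewrite /loose setDDK // minnC cutC. Qed.

(* Splitting off a component K of A1 that has fewer edges to the rest of A than
   to the outside keeps A1 loose; moving any other component across does. *)
Lemma loose_min_conn A1 : vset A1 -> A1 \subset A -> loose A1 ->
  (forall K, vset K -> K \subset A -> loose K ->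
     cut A1 (A :\: A1) <= cut K (A :\: K)) -> conn A1.
Proof.
move=> v1 s1 l1 min; apply/connP => K vK sK cK0.
have [-> | K0] := eqVneq K set0; first by left.
have [-> | K1] := eqVneq K A1; first by right.
exfalso; set K' := A1 :\: K in cK0; set A2 := A :\: A1.
have sKA := subset_trans sK s1.
have sK' : K' \subset A1 by apply: subsetDl.
have sK'A := subset_trans sK' s1.
have K'0 : K' != set0 by rewrite setD_eq0; apply: contra K1 => h; rewrite eqEsubset sK.
have DK : A :\: K = K' :|: A2.
  apply/setP => d; rewrite !inE; have /implyP := subsetP s1 d; have /implyP := subsetP sK d.
  by case: (d \in K); case: (d \in A1); case: (d \in A).
have DK' : A :\: K' = K :|: A2.
  apply/setP => d; rewrite !inE; have /implyP := subsetP s1 d; have /implyP := subsetP sK d.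
  by case: (d \in K); case: (d \in A1); case: (d \in A).
have disA2 (E : {set D}) : E \subset A1 -> [disjoint E & A2].
  by move=> sE; apply: (disjointWl sE); apply: disjoint_setD.
have pos E : vset E -> E \subset A1 -> E != set0 -> 0 < cut E (A :\: E).
  move=> vE sE; rewrite lt0n; apply: contraNN => /eqP c0.
  case: (connP _ cA E vE (subset_trans sE s1) c0) => [-> // | EA].
  have e1 : A1 = A by apply/eqP; rewrite eqEsubset s1 -EA.
  move: l1; rewrite /loose e1 setDv; have -> : cut set0 B = 0.
    by apply/eqP/cut_eq0P => d; rewrite inE.
  by rewrite minn0.
have p := pos _ vK sK K0; have p' := pos _ (vsetD v1 vK) sK' K'0.
have m := min _ vK sKA; have m' := min _ (vsetD v1 vK) sK'A.
have e1 := cutDl A2 sK; have e2 := cutDl B sK; rewrite -/K' in e1 e2.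
have e3 : cut K (A :\: K) = cut K A2 by rewrite DK cutUr ?disA2 // cK0.
have e4 : cut K' (A :\: K') = cut K' A2 by rewrite DK' cutUr ?disA2 // cutC cK0.
have e5 : cut (A :\: K) B = cut K' B + cut A2 B by rewrite DK cutUl ?disA2.
have e6 : cut (A :\: K') B = cut K B + cut A2 B by rewrite DK' cutUl ?disA2.
move: l1 m m' p p'; rewrite /loose !leq_min e2 e3 e4 e5 e6 -/A2 e1.
move=> /andP [l1 l2] m m' p p'.
have [h | h] := ltnP (cut K A2) (cut K B).
  have hq : cut K A2 < cut K' B + cut A2 B by clear -l2 p'; lia.
  by rewrite h hq in m; have := m isT; clear -p'; lia.
have h' : cut K' A2 < cut K' B by clear -h l1; lia.
have hq : cut K' A2 < cut K B + cut A2 B by clear -l2 p; lia.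
by rewrite h' hq in m'; have := m' isT; clear -p; lia.
Qed.

(** A loose part with fewest crossing edges is connected, and so is the rest of [A]. Both are then
    bonds with fewer edges than that of [A], hence light by [small]; together they meet all edges
    that [A] meets, against [heavy]. *)
Lemma tight A1 : vset A1 -> A1 \subset A -> ~~ loose A1.
Proof.
have [n] := ubnP (cut A1 (A :\: A1)); elim: n A1 => // n IH A1 len v1 s1.
apply/negP => l1.
have min K : vset K -> K \subset A -> loose K ->
    cut A1 (A :\: A1) <= cut K (A :\: K).
  move=> vK sK lK; rewrite leqNgt; apply/negP => lt.
  by have := IH K (leq_trans lt len) vK sK; rewrite lK.
set A2 := A :\: A1; have v2 : vset A2 by apply: vsetD.
have s2 : A2 \subset A by apply: subsetDl.
have c1 : conn A1 := loose_min_conn v1 s1 l1 min.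
have c2 : conn A2.
  apply: loose_min_conn => //; first by rewrite looseC.
  by move=> K vK sK lK; rewrite setDDK // cutC; apply: min.
have [p q] : cut A1 A2 < cut A1 B /\ cut A1 A2 < cut A2 B.
  by move: l1; rewrite /loose leq_min => /andP [].
have C1 : ~: A1 = A2 :|: B.
  apply/setP => d; rewrite !inE; have /implyP := subsetP s1 d.
  by case: (d \in A1); case: (d \in A).
have C2 : ~: A2 = A1 :|: B.
  apply/setP => d; rewrite !inE; have /implyP := subsetP s1 d.
  by case: (d \in A1); case: (d \in A).
have vB := vsetC vA.
have b1 : bond A1 by rewrite /bond v1 c1 C1 connU // (leq_ltn_trans _ q).
have b2 : bond A2 by rewrite /bond v2 c2 C2 connU // (leq_ltn_trans _ p).
have l := cutDl B s1; rewrite -/A2 in l.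
have d1 := cut_splitC s1 erefl; have d2 := cut_splitC s2 erefl.
rewrite -/A2 in d1; rewrite setDDK // (cutC A2 A1) in d2.
have P1 : A1 \proper A.
  rewrite properEneq s1 andbT; apply/eqP => e.
  have /cut_gt0P [d] := leq_ltn_trans (leq0n _) q.
  by rewrite /A2 e setDv inE.
have P2 : A2 \proper A.
  rewrite properEneq s2 andbT; apply/eqP => e.
  have /cut_gt0P [d] := leq_ltn_trans (leq0n _) p.
  by move=> dA1 _; have := subsetP s1 d dA1; rewrite -e inE dA1.
have S1 := small b1 P1; have S2 := small b2 P2.
have card : #|A1| + #|A2| = #|A| by rewrite -(cardsID A1 A) (setIidPr s1).
move: shortA heavy S1 S2; rewrite d1 d2 l -card => short hv.
have le1 : cut A1 A2 + cut A1 B <= L by move: short q; clear; lia.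
have le2 : cut A1 A2 + cut A2 B <= L by move: short p; clear; lia.
move=> /(_ le1) S1 /(_ le2) S2; move: hv S1 S2; clear; lia.
Qed.

End Tight.

(** * The boundary cycle of a bond *)

Lemma parityE Q A : parity Q A = odd #|A :&: Q|.
Proof.
rewrite -sum1_card (big_morph odd oddD (erefl (odd 0))) /parity.
rewrite (bigID (mem Q)) /= [X in _ (+) X]big1 ?addbF; last by move=> d /andP [_ /negPf].
by apply: eq_big => d; [rewrite inE | case/andP].
Qed.

Lemma parityD Q R A : parity [set d | (d \in Q) (+) (d \in R)] A =
  parity Q A (+) parity R A.
Proof. by rewrite /parity -big_split /=; apply: eq_bigr => d _; rewrite inE. Qed.

Lemma parity_vset C d : vset C ->
  parity [set x | (x \in C) (+) (alpha x \in C)] (porbit phi d) = false.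
Proof.
move=> /vsetP vC; rewrite /parity.
under eq_bigr do rewrite inE -(vC (alpha _)) -face_permE.
rewrite big_split /= [X in X (+) _](reindex_inj (@perm_inj _ phi)) /=.
under eq_bigl do rewrite porbit_sym -eq_porbit_mem (porbit_perm _ 1) eq_porbit_mem porbit_sym.
by rewrite addbb.
Qed.

Definition exits A := [set d in A | alpha d \notin A].

Lemma card_exits A : #|exits A| = cut A (~: A).
Proof. by apply: eq_card => d; rewrite !inE. Qed.

(* The face of an exit d is left by d; it is entered again through some edge
   whose dart in A is the next exit. The choice of that edge depends on the face
   only. *)
Definition next_exit A d : D :=
  alpha (odflt d [pick y in porbit phi d | (y \notin A) && (alpha y \in A)]).

Lemma next_exitP A d : vset A -> d \in exits A ->
  (next_exit A d \in exits A) /\ (alpha (next_exit A d) \in porbit phi d).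
Proof.
move=> /vsetP vA; rewrite inE => /andP [dA adA]; rewrite /next_exit.
case: pickP => [y /and3P [yd yA ayA] | no] /=; first by rewrite alphaK inE ayA alphaK.
(* Without such a dart the face walk from [d] would stay outside [A] for ever, yet it returns to
   [d]. *)
have out i : (phi ^+ i.+1)%g d \notin A.
  elim: i => [|i IH]; first by rewrite expg1 face_permE vA.
  rewrite expgSr permM face_permE vA; have /= := no ((phi ^+ i.+1)%g d).
  by rewrite mem_porbit IH /= => ->.
have := out #[phi]%g.-1; rewrite prednK ?order_gt0 // expg_order perm1.
by rewrite dA.
Qed.

Lemma next_exit_face A d e : vset A -> d \in exits A -> e \in porbit phi d ->
  next_exit A e = next_exit A d.
Proof.
move=> vA dX; rewrite -eq_porbit_mem => /eqP ed; rewrite /next_exit ed.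
case: pickP => // no.
have [+ h] := next_exitP vA dX; rewrite inE => /andP [nA aN].
by have := no (alpha (next_exit A d)); rewrite /= h aN alphaK nA.
Qed.

Let next_closed A (Y : {set D}) :=
  [&& Y != set0, Y \subset exits A & [forall d in Y, next_exit A d \in Y]].

(* A minimal set Y of exits closed under next_exit is a closed dual curve, so by
   the Jordan lemma its edges form a cut; a bond contains no smaller cut. *)
Lemma min_closed_exits A Y : bond A -> minset (next_closed A) Y ->
  Y = exits A /\ {in Y &, injective (next_exit A)}.
Proof.
move=> /and3P [vA cA cB] /minsetP [/and3P [Y0 sY /forall_inP nY] minY].
(* The image of [Y] is again closed, so minimality makes [next_exit] a permutation of [Y]. *)
have imY : next_exit A @: Y = Y.
  apply: minY; last by apply/subsetP => _ /imsetP [d dY ->]; apply: nY.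
  apply/and3P; split.
  - by have /set0Pn [d dY] := Y0; apply/set0Pn; exists (next_exit A d); apply: imset_f.
  - by apply/subsetP => _ /imsetP [d dY ->]; apply/(subsetP sY)/nY.
  - by apply/forall_inP => _ /imsetP [d dY ->]; apply/imset_f/nY.
have inj : {in Y &, injective (next_exit A)} by apply/imset_injP; rewrite imY.
split=> //; apply/eqP; rewrite eqEsubset sY /=.
have YA d : d \in Y -> (d \in A) * (alpha d \in A = false).
  by move/(subsetP sY); rewrite inE => /andP [-> /negPf].
pose Q := [set d | (d \in Y) (+) (d \in [set x | alpha x \in Y])].
have [|d|C [vC QC]] := @jordan Q.
- by move=> d; rewrite !inE alphaK addbC.
- rewrite parityD !parityE; set H := porbit phi d.
  pose f x := alpha (next_exit A x).
  have -> : H :&: [set x | alpha x \in Y] = f @: (H :&: Y).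
    apply/setP => x; rewrite !inE; apply/andP/imsetP => [[xH axY] | [y]].
      have /imsetP [y yY ay] : alpha x \in next_exit A @: Y by rewrite imY.
      exists y; last by rewrite /f -ay alphaK.
      have [_] := next_exitP vA (subsetP sY _ yY); rewrite -ay alphaK => xy.
      rewrite inE yY andbT porbit_sym; move: xH xy.
      by rewrite /H -!eq_porbit_mem => /eqP -> /eqP ->.
    rewrite inE => /andP [yH yY] ->; rewrite /f alphaK nY //; split=> //.
    have [_] := next_exitP vA (subsetP sY _ yY).
    by move: yH; rewrite /H -!eq_porbit_mem => /eqP -> /eqP ->.
  rewrite card_in_imset ?addbb // => x y; rewrite !inE => /andP [_ xY] /andP [_ yY].
  by move/perm_inj; apply: inj.
(* No edge of [Q] lies inside [A] or inside its complement, so [C] is constant on each of them. The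
   two values differ because [Y] is nonempty, so every exit lies in [Y]. *)
have QA x : x \in A -> alpha x \in A -> (alpha x \in C) = (x \in C).
  move=> xA axA; have := QC x; rewrite !inE.
  case xY: (x \in Y); first by rewrite (YA _ xY) in axA.
  case axY: (alpha x \in Y); first by have := (YA _ axY).2; rewrite alphaK xA.
  by case: (x \in C); case: (alpha x \in C).
have QB x : x \notin A -> alpha x \notin A -> (alpha x \in C) = (x \in C).
  move=> xA axA; have := QC x; rewrite !inE.
  case xY: (x \in Y); first by rewrite (YA _ xY) in xA.
  case axY: (alpha x \in Y); first by rewrite (YA _ axY) in axA.
  by case: (x \in C); case: (alpha x \in C).
have vC' : vset C by apply/vsetP.
have KA : C :&: A = set0 \/ C :&: A = A.
  apply: (connP _ cA); rewrite ?vsetI ?subsetIr //; apply/eqP/cut_eq0P => x.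
  rewrite !inE => /andP [xC xA]; apply/negP => /andP [+ axA].
  by rewrite axA QA // xC.
have KB : C :&: ~: A = set0 \/ C :&: ~: A = ~: A.
  apply: (connP _ cB); rewrite ?vsetI ?vsetC ?subsetIr //.
  apply/eqP/cut_eq0P => x; rewrite !inE => /andP [xC xA]; apply/negP => /andP [+ axA].
  by rewrite axA QB // xC.
have const E x y : C :&: E = set0 \/ C :&: E = E -> x \in E -> y \in E ->
    (x \in C) = (y \in C).
  move=> h xE yE; have [/setP {}h | /setP {}h] := h; have := (h x, h y);
    by rewrite !inE xE yE !andbT => -[-> ->].
have /set0Pn [y yY] := Y0; have [yA ayA] := YA _ yY.
apply/subsetP => x; rewrite inE => /andP [xA axA].
have notY z : alpha z \notin A -> alpha z \in Y = false.
  by apply: contraNF => /YA [].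
have := QC x; have := QC y; rewrite !inE yY !notY ?ayA // !addbF.
rewrite (const _ x y KA) // (const _ (alpha x) (alpha y) KB) ?inE ?ayA //.
by move=> <- ->.
Qed.
Lemma closed_exits A Y : bond A -> Y != set0 -> Y \subset exits A ->
  (forall d, d \in Y -> next_exit A d \in Y) ->
  Y = exits A /\ {in exits A &, injective (next_exit A)}.
Proof.
move=> bA Y0 sY nY.
have [|Z minZ sZ] := @minset_exists _ (next_closed A) Y.
  by rewrite /next_closed Y0 sY; apply/forall_inP.
have [eZ inj] := min_closed_exits bA minZ.
split; last by rewrite -eZ.
by apply/eqP; rewrite eqEsubset sY -eZ.
Qed.

Section Cycle.
Variable A : {set D}.
Hypothesis bA : bond A.
Local Notation next := (next_exit A).
Local Notation L := (cut A (~: A)).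

Let vA : vset A. Proof. by case/and3P: bA. Qed.

Lemma next_in d : d \in exits A -> next d \in exits A.
Proof. by move/(next_exitP vA) => []. Qed.

Lemma next_face d : d \in exits A -> alpha (next d) \in porbit phi d.
Proof. by move/(next_exitP vA) => []. Qed.

Lemma next_inj : {in exits A &, injective next}.
Proof.
have [X0 | X0] := eqVneq (exits A) set0; first by move=> x y; rewrite X0 inE.
by have [] := closed_exits bA X0 (subxx _) next_in.
Qed.

(** The dual curve of a bond passes each face at most once; the noose inherits this. *)
Lemma exit_face_inj d e : d \in exits A -> e \in exits A ->
  e \in porbit phi d -> e = d.
Proof. by move=> dX eX ed; apply: next_inj => //; apply: next_exit_face. Qed.

Lemma orbit_next d : d \in exits A -> [set x in fingraph.orbit next d] = exits A.
Proof.
move=> dX; have homo x : fconnect next d x -> x \in exits A.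
  by move/iter_findex => <-; elim: (findex _ _ _) => //= n /next_in.
apply: (fun a b c => (closed_exits bA a b c).1).
- by apply/set0Pn; exists d; rewrite inE -fconnect_orbit connect0.
- by apply/subsetP => x; rewrite inE -fconnect_orbit => /homo.
- move=> x; rewrite !inE -!fconnect_orbit => dx.
  by apply: connect_trans dx _; apply: fconnect1.
Qed.

Lemma order_next d : d \in exits A -> fingraph.order next d = L.
Proof.
move=> dX; rewrite -card_exits -(orbit_next dX) cardsE.
by rewrite (card_uniqP (fingraph.orbit_uniq _ _)) fingraph.size_orbit.
Qed.

Lemma iter_next_in n d : d \in exits A -> iter n next d \in exits A.
Proof. by move=> dX; elim: n => //= n /next_in. Qed.

Lemma iter_next_period d : d \in exits A -> iter L next d = d.
Proof.
by move=> dX; rewrite -(order_next dX) (iter_order_in next_in next_inj).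
Qed.

Lemma traject_next_uniq d n : d \in exits A -> n <= L -> uniq (traject next d n).
Proof.
move=> dX nL; have := fingraph.orbit_uniq next d; rewrite /fingraph.orbit order_next //.
by rewrite -(subnKC nL) trajectD cat_uniq => /andP [].
Qed.

Lemma iter_next_inj d i j : d \in exits A -> i < L -> j < L ->
  iter i next d = iter j next d -> i = j.
Proof.
move=> dX iL jL e; apply/eqP; rewrite -(nth_uniq d _ _ (traject_next_uniq dX (leqnn L)))
  ?size_traject //.
by rewrite !nth_traject ?e.
Qed.

Lemma exit_iter d e : d \in exits A -> e \in exits A ->
  exists2 i, i < L & e = iter i next d.
Proof.
move=> dX; rewrite -(orbit_next dX) inE => /trajectP.
by rewrite order_next.
Qed.

End Cycle.

(* Q is an F_2-chain of dual edges with boundary face(u) + face(v). *)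
Definition joins Q u v :=
  (forall d, (alpha d \in Q) = (d \in Q)) /\
  forall e, parity Q (porbit phi e) = (u \in porbit phi e) (+) (v \in porbit phi e).

Definition symdiff Q R := [set d | (d \in Q) (+) (d \in R)].

Lemma joins0 u : joins set0 u u.
Proof. by split=> [d | e]; rewrite ?inE // parityE setI0 cards0 addbb. Qed.

Lemma joins_edge d : joins [set d; alpha d] d (alpha d).
Proof.
split=> [x | e].
  have e : (alpha x == d) = (x == alpha d).
    by apply/eqP/eqP => [<- | ->]; rewrite alphaK.
  by rewrite !inE e (inj_eq perm_inj) orbC.
rewrite parityE setIC -parityE /parity big_setU1 ?big_set1 //.
by rewrite inE eq_sym alphaN.
Qed.

Lemma joins_sym Q u v : joins Q u v -> joins Q v u.
Proof. by case=> a p; split=> // e; rewrite p addbC. Qed.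

Lemma joins_trans Q R u v w : joins Q u v -> joins R v w -> joins (symdiff Q R) u w.
Proof.
move=> [Qa Qp] [Ra Rp]; split=> [d | e]; first by rewrite !inE Qa Ra.
by rewrite parityD Qp Rp addbA addbK.
Qed.

Lemma joins_face Q u v w : joins Q u v -> w \in porbit phi v -> joins Q u w.
Proof.
move=> [Qa Qp] wv; split=> // e; rewrite Qp; congr addb.
by rewrite porbit_sym [RHS]porbit_sym; move: wv; rewrite -eq_porbit_mem => /eqP ->.
Qed.

Lemma card_symdiff_edge Q d : #|symdiff Q [set d; alpha d]| <= #|Q| + 2.
Proof.
have s : symdiff Q [set d; alpha d] \subset Q :|: [set d; alpha d].
  by apply/subsetP => x; rewrite !inE; case: (x \in Q).
apply: leq_trans (subset_leq_card s) _; apply: leq_trans (leq_card_setU _ _) _.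
by rewrite leq_add2l cards2; case: (_ != _).
Qed.
(** * Dual distances inside a minimal bond *)

Section Distance.
Variable A : {set D}.
Hypothesis bA : bond A.
Hypothesis tightA : forall A1, vset A1 -> A1 \subset A -> ~~ loose A A1.
Local Notation next := (next_exit A).
Local Notation L := (cut A (~: A)).

Let vA : vset A. Proof. by case/and3P: bA. Qed.

(** The face of an exit is the one reached after crossing it, so the arc from the face of [d]
    crosses the [n] exits following [d] and not [d] itself. *)
Fixpoint arcs d n : {set D} :=
  if n is m.+1 then
    symdiff (arcs d m) [set iter n next d; alpha (iter n next d)]
  else set0.

Lemma joins_arc d n : d \in exits A -> joins (arcs d n) d (iter n next d).
Proof.
move=> dX; elim: n => [|n IH]; first exact: joins0.
set y := iter n.+1 next d.
have h : joins (arcs d n) d (alpha y).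
  by apply: joins_face IH _; apply: next_face (iter_next_in bA _ dX).
apply: joins_trans h _.
by have := joins_edge (alpha y); rewrite alphaK setUC.
Qed.

Lemma arc_exits d n e : d \in exits A -> e \in arcs d n ->
  e \in exits A \/ alpha e \in exits A.
Proof.
move=> dX; elim: n => [|n IH] /=; first by rewrite inE.
case eA : (e \in arcs d n) => h; first exact: IH.
move: h; rewrite inE eA /= in_set2.
case/orP => /eqP ->; [left | right; rewrite alphaK]; exact: (iter_next_in bA n.+1 dX).
Qed.

Lemma mem_arc_exit d n e : d \in exits A -> e \in exits A -> n <= L ->
  (e \in arcs d n) = (e \in traject next (next d) n).
Proof.
move=> dX eX; elim: n => [|n IH] nL; first by rewrite inE.
rewrite [LHS]inE (IH (ltnW nL)) trajectSr mem_rcons -iterSr !inE.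
have -> : (e == alpha (iter n.+1 next d)) = false.
  apply/eqP => ee; have := iter_next_in bA n.+1 dX; move: eX.
  by rewrite ee !inE => /andP [-> _]; rewrite andbF.
have := traject_next_uniq bA (next_in bA dX) nL.
rewrite trajectSr rcons_uniq -iterSr orbF => /andP [nt _].
case: eqVneq => [-> | _]; first by rewrite (negPf nt).
by rewrite addbF.
Qed.

Lemma card_exits_arc d n : d \in exits A -> n <= L -> #|exits A :&: arcs d n| = n.
Proof.
move=> dX nL; have tu := traject_next_uniq bA (next_in bA dX) nL.
rewrite -[RHS](size_traject next (next d) n) -(card_uniqP tu).
apply: eq_card => e; rewrite inE; apply/andP/idP => [[eX] | et].
  by rewrite mem_arc_exit.
have eX : e \in exits A.
  by have /trajectP [i _ ->] := et; rewrite -iterSr; apply: iter_next_in.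
by rewrite eX mem_arc_exit.
Qed.

(** The set given by [jordan] is constant on the connected complement of [A], so it or its
    complement, which has the same edge cut, lies in [A]. *)
Lemma inside_jordan Q d : joins Q d d ->
  (forall e, e \in Q -> (e \in A) || (alpha e \in A)) ->
  exists C, [/\ vset C, C \subset A & forall e, (e \in Q) = (e \in C) (+) (alpha e \in C)].
Proof.
move=> [Qa Qp] QA; have [|C [vC QC]] := jordan Qa; first by move=> e; rewrite Qp addbb.
have vC' : vset C by apply/vsetP.
have /and3P [_ _ cB] := bA.
have QB x : x \notin A -> alpha x \notin A -> (alpha x \in C) = (x \in C).
  move=> /negPf xA /negPf axA; have := QC x; have := QA x; rewrite xA axA.
  by case: (x \in Q) => [/(_ isT) // | _]; case: (x \in C); case: (alpha x \in C).
have [KB | KB] : C :&: ~: A = set0 \/ C :&: ~: A = ~: A.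
  apply: (connP _ cB); rewrite ?vsetI ?vsetC ?subsetIr //.
  apply/eqP/cut_eq0P => x; rewrite !inE => /andP [xC xA]; apply/negP => /andP [+ axA].
  by rewrite axA QB // xC.
- exists C; split=> //; apply/subsetP => x xC; apply/negPn/negP => xA.
  by have /setP/(_ x) := KB; rewrite !inE xC xA.
- exists (~: C); split; first exact: vsetC.
    apply/subsetP => x; rewrite inE; apply: contraNT => xA.
    by have /setP/(_ x) := KB; rewrite !inE xA andbT.
  by move=> e; rewrite QC !inE addNb addbN negbK.
Qed.

(** With the boundary arc, [Q] closes up to the edge cut of some [C] inside [A]. If [C] has [s]
    exits of [A], then [Q] contains at least [minn s (L - s)] edges inside [A], because [C] is not
    loose; and [s] differs from [n] by at most the number of exits in [Q]. The factor 2 is the two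
    darts of an edge. *)
Lemma dual_distance Q d n : d \in exits A -> n <= L -> joins Q d (iter n next d) ->
  (forall e, e \in Q -> (e \in A) || (alpha e \in A)) ->
  2 * minn n (L - n) <= #|Q|.
Proof.
move=> dX nL jQ QA; pose S := symdiff Q (arcs d n).
have aX e : e \in exits A -> alpha e \notin A by rewrite inE => /andP [].
have XA e : e \in exits A -> e \in A by rewrite inE => /andP [].
have [|e|C [vC sC SC]] := @inside_jordan S d.
- by apply: joins_trans jQ _; apply/joins_sym/joins_arc.
- rewrite inE; case eQ : (e \in Q); first by rewrite QA.
  by case/(arc_exits dX) => /XA ->; rewrite ?orbT.
have eC : cut C (~: A) = #|exits A :&: S|.
  apply: eq_card => e; rewrite !inE.
  have := SC e; rewrite inE => ->.
  have /implyP := subsetP sC e; have /implyP := subsetP sC (alpha e).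
  by case: (e \in A); case: (e \in C); case: (alpha e \in A); case: (alpha e \in C).
have eAC : #|exits A :&: S| + cut (A :\: C) (~: A) = L by rewrite -eC -cutDl.
have cX := card_exits_arc dX nL.
set a := #|exits A :&: Q|.
have le1 : n <= #|exits A :&: S| + a.
  rewrite -[X in X <= _]cX; apply: leq_trans (leq_card_setU _ _).
  apply/subset_leq_card/subsetP => e; rewrite !inE.
  by case: (e \in A); case: (alpha e \in A); case: (e \in Q); case: (e \in arcs d n).
have le2 : #|exits A :&: S| <= n + a.
  rewrite -[X in X + _]cX; apply: leq_trans (leq_card_setU _ _).
  apply/subset_leq_card/subsetP => e; rewrite !inE.
  by case: (e \in A); case: (alpha e \in A); case: (e \in Q); case: (e \in arcs d n).
have le3 : 2 * cut C (A :\: C) + 2 * a <= #|Q|.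
  have [Qa _] := jQ.
  have inQ e : (e \in C) (+) (alpha e \in C) -> e \in A -> alpha e \in A -> e \in Q.
    rewrite -SC inE => + eA aA; case eR: (e \in arcs d n); last by rewrite addbF.
    by case: (arc_exits dX eR) => /aX; rewrite ?alphaK ?eA ?aA.
  rewrite -(cardsID A Q).
  have h4 : a <= #|Q :\: A|.
    rewrite /a -(card_imset _ (@perm_inj _ alpha)).
    apply/subset_leq_card/subsetP => _ /imsetP [e + ->].
    by rewrite !inE Qa => /andP [/andP [_ ->] ->].
  have h3 : cut C (A :\: C) + cut (A :\: C) C + a <= #|Q :&: A|.
    have disj (X Y : {set D}) : [disjoint X & Y] -> #|X| + #|Y| = #|X :|: Y|.
      by move=> dXY; apply/eqP; rewrite eq_sym (leq_card_setU X Y).2.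
    rewrite /cut /a !disj.
    - apply/subset_leq_card/subsetP => e; rewrite !inE => /orP [/orP [] |].
      + move=> /andP [eC' /andP [naC aA]]; have eA := subsetP sC e eC'.
        by rewrite eA inQ // eC' (negPf naC).
      + move=> /andP [/andP [nC eA] aC]; have aA := subsetP sC _ aC.
        by rewrite eA inQ // aC (negPf nC).
      + by move=> /andP [/andP [-> _] ->].
    - rewrite disjoints_subset; apply/subsetP => e; rewrite !inE.
      case/orP => [/andP [_ /andP [_ ->]] | /andP [_ /(subsetP sC) ->]];
      by rewrite andbF.
    - rewrite disjoints_subset; apply/subsetP => e; rewrite !inE.
      by move=> /andP [-> _].
  rewrite (cutC (A :\: C)) in h3; clear -h3 h4; lia.
have := tightA vC sC; rewrite /loose -leqNgt geq_min eC.
move: eAC le1 le2 le3; rewrite -/a.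
move: (cut C (A :\: C)) (cut (A :\: C) _) #|_ :&: S| a #|Q| L => c q s b t l.
by clear; lia.
Qed.

End Distance.

(** * Chains and paths of faces *)

Lemma involution_even (X : {set D}) : (forall d, (alpha d \in X) = (d \in X)) -> odd #|X| = false.
Proof.
have [n] := ubnP #|X|; elim: n X => // n IH X lt aX.
have [-> | [d dX]] := set_0Vmem X; first by rewrite cards0.
have sub : [set d; alpha d] \subset X by rewrite subUset !sub1set aX dX.
have c2 : #|[set d; alpha d]| = 2 by rewrite cards2 eq_sym alphaN.
have := cardsID [set d; alpha d] X; rewrite (setIidPr sub) c2 => e.
rewrite -e oddD /= IH //; first by move: lt; rewrite -e !addSn add0n ltnS => /ltnW.
move=> x; rewrite !inE aX (inj_eq perm_inj) orbC.
by have -> : (alpha x == d) = (x == alpha d); first by apply/eqP/eqP => [<- | ->]; rewrite alphaK.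
Qed.

Definition face_step Q : rel {set D} := fun H H' =>
  [exists y in Q, (H == porbit phi y) && (H' == porbit phi (alpha y))].

Lemma porbit_eqP (s : {perm D}) d e : reflect (porbit s d = porbit s e) (d \in porbit s e).
Proof. by rewrite -eq_porbit_mem; apply: eqP. Qed.

(* Handshake: the union of the faces reached from u inside Q cannot contain u
   as its only face of odd degree. *)
Lemma joins_connect Q u v : joins Q u v ->
  connect (face_step Q) (porbit phi u) (porbit phi v).
Proof.
move=> [Qa Qp]; apply/negPn/negP => nc.
pose X := [set d in Q | connect (face_step Q) (porbit phi u) (porbit phi d)].
have aX d : alpha d \in X -> d \in X.
  rewrite !inE Qa => /andP [dQ c]; rewrite dQ; apply: connect_trans c (connect1 _).
  by apply/exists_inP; exists (alpha d); rewrite ?Qa // alphaK !eqxx.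
have ev : odd #|X| = false.
  by apply: involution_even => d; apply/idP/idP => [/aX // | dX]; apply: aX; rewrite alphaK.
have : parity X setT = false by rewrite parityE setTI.
rewrite /parity (partition_big (porbit phi) (mem (porbits phi))) /=; last first.
  by move=> d _; apply: imset_f.
have inner e : \big[addb/false]_(d in setT | porbit phi d == porbit phi e) (d \in X) =
    (u \in porbit phi e).
  under eq_bigl do rewrite inE /= eq_porbit_mem.
  have [c | c] := boolP (connect (face_step Q) (porbit phi u) (porbit phi e)).
    have -> : (u \in porbit phi e) = parity Q (porbit phi e).
      rewrite Qp; case ve : (v \in _); last by rewrite addbF.
      by move/porbit_eqP: ve c => <- c; rewrite c in nc.
    by apply: eq_bigr => d /porbit_eqP dX; rewrite inE dX c andbT.
  rewrite big1; last by move=> d /porbit_eqP dX; rewrite inE dX (negPf c) andbF.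
  by case: porbit_eqP c => // ->; rewrite connect0.
rewrite (bigD1 (porbit phi u)) ?imset_f //= inner porbit_id big1 //.
move=> _ /andP [/imsetP [e _ ->] ne]; rewrite inner.
by apply/negbTE; apply: contra ne => /porbit_eqP ->.
Qed.

Definition incident A Q := forall e, e \in Q -> (e \in A) || (alpha e \in A).

Lemma path_joins A Q u v p : incident A Q -> path (face_step Q) (porbit phi u) p ->
  last (porbit phi u) p = porbit phi v ->
  exists R, [/\ joins R u v, incident A R & #|R| <= 2 * size p].
Proof.
move=> QA; elim: p u => [|H p IH] u /=.
  move=> _ uv; exists set0; rewrite cards0; split=> //; last by move=> e; rewrite inE.
  by apply: joins_face (joins0 u) _; apply/porbit_eqP.
case/andP=> /exists_inP [y yQ /andP [/eqP uy /eqP ->]] pp lp.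
have [R [jR RA cR]] := IH _ pp lp.
exists (symdiff R [set y; alpha y]); split.
- apply: joins_sym; apply: joins_trans (joins_sym jR) _.
  by apply: joins_face (joins_sym (joins_edge y)) _; apply/porbit_eqP.
- move=> e; rewrite inE; case eR : (e \in R) => /=; first by rewrite RA.
  by rewrite !inE => /orP [] /eqP ->; rewrite ?alphaK; have := QA _ yQ; rewrite // orbC.
- apply: leq_trans (card_symdiff_edge _ _) _; clear -cR; lia.
Qed.

(** * Breadth-first layers of faces *)

Section Levels.
Variables (A : {set D}) (x0 : D).
Hypothesis sigma3 : forall d, sigma (sigma (sigma d)) = d.
Hypothesis bA : bond A.
Hypothesis tightA : forall A1, vset A1 -> A1 \subset A -> ~~ loose A A1.
Hypothesis x0X : x0 \in exits A.
Local Notation L := (cut A (~: A)).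
Local Notation b l := (iter l (next_exit A) x0).

Let vA : vset A. Proof. by case/and3P: bA. Qed.

(** A union of faces, kept as a set of darts: those at dual distance at most [r] from the face of
    [x0], where a step crosses an edge meeting [A]. *)
Fixpoint ball r : {set D} :=
  if r is s.+1 then
    [set d | (d \in ball s) || [exists y in porbit phi d,
       (alpha y \in ball s) && ((y \in A) || (alpha y \in A))]]
  else porbit phi x0.

Lemma ball_face r d e : e \in porbit phi d -> (e \in ball r) = (d \in ball r).
Proof.
move=> /porbit_eqP ed; elim: r => [|r IH] /=; last by rewrite !inE IH ed.
by rewrite -!eq_porbit_mem ed.
Qed.

Lemma ballS r d : d \in ball r -> d \in ball r.+1.
Proof. by rewrite inE => ->. Qed.

Lemma ball_leq r s d : r <= s -> d \in ball r -> d \in ball s.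
Proof. by move/subnK <-; elim: (s - r) => // k IH /IH /ballS. Qed.

Lemma ball_step r d : (d \in A) || (alpha d \in A) -> alpha d \in ball r ->
  d \in ball r.+1.
Proof.
move=> dA ad; rewrite inE; apply/orP; right.
by apply/exists_inP; exists d; rewrite ?porbit_id // ad.
Qed.

(** The edge of [d] separates the faces of [d] and [alpha d], and the latter is also the face of
    [sigma d]: consecutive corners at a vertex lie in the same or in adjacent faces. *)
Lemma ball_sigma r d : (sigma d \in ball r) = (alpha d \in ball r).
Proof.
apply: ball_face; have := mem_porbit phi 1 (alpha d).
by rewrite expg1 face_permE alphaK.
Qed.

Lemma ball_corner r d : d \in A -> sigma d \in ball r -> d \in ball r.+1.
Proof. by move=> dA; rewrite ball_sigma; apply: ball_step; rewrite dA. Qed.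

Lemma ball_cornerV r d : d \in A -> d \in ball r -> sigma d \in ball r.+1.
Proof.
by move=> dA; rewrite ball_sigma => h; apply: ball_step; rewrite alphaK // dA orbT.
Qed.

Lemma ball_joins r d : d \in ball r ->
  exists Q, [/\ joins Q x0 d, incident A Q & #|Q| <= 2 * r].
Proof.
elim: r d => [|r IH] d /=.
  move=> dx; exists set0; rewrite cards0; split=> //; last by move=> e; rewrite inE.
  exact: joins_face (joins0 x0) dx.
rewrite inE => /orP [/IH [Q [jQ iQ cQ]] | /exists_inP [y yd /andP [/IH [Q [jQ iQ cQ]] yA]]].
  by exists Q; split=> //; apply: leq_trans cQ _; rewrite leq_mul.
exists (symdiff Q [set alpha y; alpha (alpha y)]); split.
- apply: joins_face (joins_trans jQ (joins_edge _)) _.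
  by rewrite alphaK porbit_sym.
- move=> e; rewrite inE; case eQ : (e \in Q) => /=; first by rewrite iQ.
  by rewrite !inE alphaK => /orP [] /eqP ->; rewrite ?alphaK // orbC.
- by apply: leq_trans (card_symdiff_edge _ _) _; rewrite mulnS addnC leq_add2l.
Qed.

Lemma bX l : b l \in exits A. Proof. exact: iter_next_in. Qed.

Lemma bP l : (b l \in A) * (alpha (b l) \in A = false).
Proof. by have := bX l; rewrite inE => /andP [-> /negPf]. Qed.

Lemma b_period l : b (L + l) = b l.
Proof. by rewrite addnC iterD iter_next_period. Qed.

Lemma ball_alpha_b r l : (alpha (b l.+1) \in ball r) = (b l \in ball r).
Proof. by apply: ball_face; apply: next_face (bX l). Qed.

Lemma b_ball l : b l \in ball l.
Proof.
elim: l => [|l IH]; first exact: porbit_id.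
by apply: ball_step; rewrite ?bP // ball_alpha_b.
Qed.

Lemma b_ballV l : l <= L -> b (L - l) \in ball l.
Proof.
elim: l => [|l IH] lL; first by rewrite subn0 iter_next_period ?porbit_id.
rewrite -ball_alpha_b subnSK //; apply: ball_step; first by rewrite alphaK !bP.
by rewrite alphaK IH // ltnW.
Qed.

Lemma ball_b r l : l <= L -> b l \in ball r -> minn l (L - l) <= r.
Proof.
move=> lL /ball_joins [Q [jQ iQ cQ]].
have := leq_trans (dual_distance bA tightA x0X lL jQ iQ) cQ.
by rewrite leq_pmul2l.
Qed.

Section Level.
Variable r : nat.

(* Vertices of A incident with a face at distance at most r; the edges leaving
   this set inside A run between faces at distance exactly r + 1. *)
Definition touching :=
  [set d in A | [|| d \in ball r, sigma d \in ball r | sigma (sigma d) \in ball r]].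

Lemma vset_touching : vset touching.
Proof.
apply/vsetP => d; rewrite !inE (vsetP _ vA) sigma3.
by rewrite orbA orbC.
Qed.

Definition level_edges :=
  [set d in A | (alpha d \in A) && ((d \in touching) (+) (alpha d \in touching))].

(** Both faces along such an edge also touch its far end, so they are not in [ball r]. At the
    touching end only the third corner can be, and with degree three it is adjacent to both of
    them. *)
Lemma level_edges_ball d : d \in level_edges ->
  (d \in ball r.+1) * (d \in ball r = false).
Proof.
have key e : e \in touching -> alpha e \in A -> alpha e \notin touching ->
   [/\ e \notin ball r, alpha e \notin ball r, sigma (sigma e) \in ball r & e \in A].
  rewrite !inE => /andP [eA te] aA; rewrite aA /= !negb_or => /and3P [na ns _].
  have ne : e \notin ball r.
    by have := ns; rewrite ball_sigma alphaK.
  by move: te; rewrite (negPf ne) ball_sigma (negPf na).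
have vAd := vsetP _ vA.
rewrite inE => /and3P [dA aA]; case td : (d \in touching) => /=.
  move=> ta; have [ne na ss _] := key _ td aA ta; rewrite (negPf ne); split=> //.
  by rewrite -(sigma3 d); apply: ball_cornerV; rewrite ?vAd.
move=> ta; have [||ne na ss _] := key (alpha d) ta.
- by rewrite alphaK.
- by rewrite alphaK td.
rewrite alphaK in na; rewrite (negPf na); split=> //.
by have := ball_corner _ ss; rewrite vAd ball_sigma alphaK; apply.
Qed.

(** The edge cut of [touching] is even on every face. Its part inside [A] is [level_edges]; the rest
    is the boundary arc across the exits [b (L - r)] up to [b (L + r.+1)]. Hence [level_edges] has
    the same ends as that arc. *)
Lemma joins_level : 2 * r.+1 + 2 <= L ->
  joins level_edges (b (L - r.+1)) (b r.+1).
Proof.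
move=> rL; set d0 := b (L - r.+1).
have e0 : iter (2 * r.+1) (next_exit A) d0 = b r.+1.
  rewrite /d0 -iterD -(b_period r.+1); congr (iter _ (next_exit A) x0); move: rL; move: (cut _ _) => l; clear; lia.
have jR : joins (arcs A d0 (2 * r.+1)) d0 (b r.+1).
  by rewrite -e0; apply: joins_arc (bX _).
set R := arcs A d0 _ in jR *.
suff E d : (d \in level_edges) =
    ((d \in touching) (+) (alpha d \in touching)) (+) (d \in R).
  have [Ra Rp] := jR.
  split=> [d | e]; first by rewrite !E Ra alphaK (addbC (alpha d \in _)).
  have -> : level_edges = symdiff [set d | (d \in touching) (+) (alpha d \in touching)] R
      by apply/setP => d; rewrite E !inE.
  by rewrite parityD parity_vset ?vset_touching ?Rp.
have exitE e : e \in exits A -> (e \in touching) = (e \in R).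
  move=> eX; rewrite /R mem_arc_exit ?bX //; last by move: rL; move: (cut _ _) => l; clear; lia.
  apply/idP/trajectP => [| [i ilt ->]].
    rewrite inE => /andP [eA te].
    have eb : e \in ball r.+1.
      case/or3P: te => [/ballS // | /(ball_corner eA) // | h].
      by rewrite -(sigma3 e); apply: ball_cornerV; rewrite ?(vsetP _ vA).
    have ab : alpha e \in ball r.+1.
      rewrite -ball_sigma; case/or3P: te => [/(ball_cornerV eA) // | /ballS // | h].
      by apply: ball_corner; rewrite ?(vsetP _ vA).
    have [l lL el] : exists2 l, l < L & e = b l.+1.
      have [[|i] iL ei] := exit_iter bA x0X eX; last by exists i => //; apply: ltnW.
      exists L.-1; first by move: rL; move: (cut _ _) => l; clear; lia.
      rewrite prednK; first by rewrite iter_next_period.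
      by apply: leq_ltn_trans iL.
    rewrite el in eb; rewrite el ball_alpha_b in ab.
    (* Both faces of the exit, numbered [l.+1] and [l], are cyclically within [r.+1] of 0. As
       [2 * r.+1 + 2 <= L], only exits of the arc satisfy both bounds. *)
    have m1 := ball_b lL eb; have m2 := ball_b (ltnW lL) ab.
    have [lr | lr] := leqP l r.
      exists (r.+1 + l); first by clear -lr; lia.
      rewrite el -iterSr /d0 -iterD -(b_period l.+1); congr (iter _ (next_exit A) x0).
      by move: rL; move: (cut _ _) => c; clear; lia.
    exists (l - (L - r.+1)); first by move: lL; move: (cut _ _) => c; clear; lia.
    rewrite el -iterSr /d0 -iterD; congr (iter _ (next_exit A) x0).
    by move: m1 m2 lr rL lL; move: (cut _ _) => c; clear; lia.
  (* Conversely, before position 0 the face reached by the exit is in [ball r]; after it, the face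
     it comes from is. *)
  rewrite -iterSr /d0 -iterD; have [ir | ir] := leqP i r.
    set m := i.+1 + _; have mE : m = L - (r - i).
      by move: rL ir; rewrite /m; move: (cut _ _) => c; clear; lia.
    rewrite inE bP mE (ball_leq (leq_subr i r)) ?b_ballV //.
    by move: rL; move: (cut _ _) => c; clear; lia.
  have -> : i.+1 + (L - r.+1) = L + (i - r.+1).+1.
    by move: rL ir; move: (cut _ _) => c; clear; lia.
  have h : b (i - r.+1) \in ball r.
    by apply: ball_leq (b_ball _); move: ilt; clear; lia.
  by rewrite b_period inE bP ball_sigma ball_alpha_b h orbT.
have aTF x : x \notin A -> (x \in touching) = false.
  by move=> /negPf xA; rewrite inE xA.
have [Ra _] := jR.
case dA : (d \in A); case aA : (alpha d \in A).
- rewrite [LHS]in_set dA aA /=; case dR : (d \in R); last by rewrite addbF.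
  by case/(arc_exits bA (bX _)): dR; rewrite inE ?alphaK dA aA.
- rewrite [LHS]in_set dA aA /= [alpha d \in touching]aTF ?aA // addbF exitE ?addbb //.
  by rewrite inE dA aA.
- rewrite [LHS]in_set dA /= [d \in touching]aTF ?dA // -Ra exitE ?addbb //.
  by rewrite inE alphaK dA aA.
- rewrite [LHS]in_set dA !aTF ?dA ?aA //=; symmetry; apply/negbTE/negP => dR.
  by case/(arc_exits bA (bX _)): dR; rewrite inE ?dA ?aA.
Qed.

End Level.
End Levels.

(** * Counting faces *)

Section CountFaces.
Variables (A : {set D}) (x0 : D).
Hypothesis sigma3 : forall d, sigma (sigma (sigma d)) = d.
Hypothesis bA : bond A.
Hypothesis tightA : forall A1, vset A1 -> A1 \subset A -> ~~ loose A A1.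
Hypothesis x0X : x0 \in exits A.
Local Notation L := (cut A (~: A)).
Local Notation b l := (iter l (next_exit A) x0).

Definition ball_faces r := [set H in porbits phi | H \subset ball A x0 r].

Lemma face_sub_ball r d : (porbit phi d \subset ball A x0 r) = (d \in ball A x0 r).
Proof.
apply/subsetP/idP => [| db e ed]; first by apply; exact: porbit_id.
by rewrite (ball_face _ _ _ ed).
Qed.

Lemma card_ball_facesS r p : uniq p ->
  (forall H, H \in p -> exists2 d, H = porbit phi d &
     (d \in ball A x0 r.+1) && (d \notin ball A x0 r)) ->
  #|ball_faces r| + size p <= #|ball_faces r.+1|.
Proof.
move=> /card_uniqP up lev; have -> : size p = #|[set H in p]| by rewrite cardsE up.
have dis : [disjoint ball_faces r & [set H in p]].
  rewrite disjoint_sym disjoints_subset; apply/subsetP => H; rewrite inE => /lev [d -> /andP [_ nd]].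
  by rewrite !inE face_sub_ball (negPf nd) andbF.
have := (leq_card_setU (ball_faces r) [set H in p]).2; rewrite dis => /eqP <-.
apply/subset_leq_card/subsetP => H; rewrite !inE => /orP [/andP [HP /subsetP Hb] | /lev [d -> /andP [db _]]].
  by rewrite HP; apply/subsetP => d /Hb; apply: ballS.
by rewrite imset_f // face_sub_ball.
Qed.

Lemma b_level r : 2 * r.+1 <= L ->
  (b r.+1 \in ball A x0 r.+1) && (b r.+1 \notin ball A x0 r) /\
  (b (L - r.+1) \in ball A x0 r.+1) && (b (L - r.+1) \notin ball A x0 r).
Proof.
move=> rL; have r1 : r.+1 <= L by apply: leq_trans rL; rewrite leq_pmull.
have nb l : l <= L -> r < minn l (L - l) -> b l \notin ball A x0 r.
  by move=> lL rl; apply/negP => /(ball_b bA tightA x0X lL); rewrite leqNgt rl.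
rewrite b_ball // b_ballV // !nb //; move: rL r1; move: (cut _ _) => l; clear; lia.
Qed.

(** A simple path across [level_edges] stays in layer [r.+1], and [dual_distance] bounds its length
    from below; the successor counts its first face. When [L] exceeds [2 * r.+1] by at most 1, one
    or two boundary faces are enough. *)
Lemma card_level r : 2 * r.+1 <= L ->
  #|ball_faces r| + (minn (2 * r.+1) (L - 2 * r.+1)).+1 <= #|ball_faces r.+1|.
Proof.
move=> rL; have [lev levV] := b_level rL.
have bX l : b l \in exits A by apply: iter_next_in.
have [big | small] := leqP (2 * r.+1 + 2) L.
  have jM := joins_level sigma3 bA tightA x0X big.
  have /connectP [p0 pp0 lp0] := joins_connect jM.
  case: (shortenP pp0) lp0 => p pp up _ lp.
  have iM : incident A (level_edges A x0 r).
    by move=> e; rewrite inE => /andP [->].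
  have [R [jR iR cR]] := path_joins iM pp (esym lp).
  have nL : 2 * r.+1 <= L by [].
  have e0 : iter (2 * r.+1) (next_exit A) (b (L - r.+1)) = b r.+1.
    rewrite -iterD -[RHS](iter_next_period bA) //.
    rewrite -iterD; congr (iter _ (next_exit A) x0).
    by move: rL; move: (cut _ _) => l; clear; lia.
  rewrite -e0 in jR; have dd := leq_trans (dual_distance bA tightA (bX _) nL jR iR) cR.
  rewrite leq_pmul2l // in dd.
  apply: leq_trans (card_ball_facesS up _); first by rewrite leq_add2l ltnS.
  move=> H; rewrite inE => /orP [/eqP -> | Hp]; first by exists (b (L - r.+1)).
  have [q1 [q2 ep]] : exists q1 q2, p = q1 ++ H :: q2.
    by have [q1 q2] := splitPr Hp; exists q1, q2.
  move: pp; rewrite ep cat_path /= => /and3P [_ /exists_inP [y yM /andP [_ /eqP ->]] _].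
  exists (alpha y) => //; have ayM : alpha y \in level_edges A x0 r.
    by move: yM; rewrite !inE alphaK => /and3P [-> ->]; rewrite addbC.
  by rewrite !(level_edges_ball sigma3 bA ayM).
have [e | ne] := eqVneq (2 * r.+1) L.
  rewrite -e subnn minn0.
  apply: (card_ball_facesS (p := [:: porbit phi (b r.+1)])) => // H.
  by rewrite inE => /eqP ->; exists (b r.+1).
have e1 : L = (2 * r.+1).+1 by move: rL small ne; move: (cut _ _) => l; clear; lia.
have -> : minn (2 * r.+1) (L - 2 * r.+1) = 1 by rewrite e1; clear; lia.
apply: (card_ball_facesS (p := [:: porbit phi (b r.+1); porbit phi (b (L - r.+1))])).
  rewrite cons_uniq mem_seq1 andbT; apply/eqP => /esym/porbit_eqP h.
  have := iter_next_inj bA x0X _ _ (exit_face_inj bA (bX r.+1) (bX (L - r.+1)) h).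
  by move: e1; move: (cut _ _) => l; clear; lia.
move=> H; rewrite !inE => /orP [] /eqP ->; first by exists (b r.+1).
by exists (b (L - r.+1)).
Qed.

(** In this range the layers have at least 1, 3, 5, ... faces. *)
Lemma card_ball_faces_low r : 4 * r <= L -> r.+1 ^ 2 <= #|ball_faces r|.
Proof.
elim: r => [|r IH] rL.
  apply/card_gt0P; exists (porbit phi x0).
  by rewrite inE imset_f //= face_sub_ball porbit_id.
have := card_level (r := r); have := IH.
move: rL; move: (cut _ _) #|_| #|_| => l n m; clear; nia.
Qed.

(** Beyond a quarter of [L], layer [a + s] has at least [L - 2 * (a + s) + 1] faces. Summing over
    [s] from 1 to [t] gives [t * (L - 2 * a) - t ^ 2]. *)
Lemma card_ball_faces_high a t : L < 4 * a.+1 -> 4 * a <= L -> 2 * (a + t) <= L ->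
  a.+1 ^ 2 + t * (L - 2 * a) <= #|ball_faces (a + t)| + t ^ 2.
Proof.
move=> La aL; elim: t => [|t IH] tL.
  by rewrite addn0 mul0n addn0; apply: leq_trans (card_ball_faces_low aL) _; apply: leq_addr.
rewrite addnS in tL *; have := card_level tL; have := IH.
move: tL La aL; move: (cut _ _) #|_| #|_| => l n m; clear.
move=> tL La aL h1; have -> : minn (2 * (a + t).+1) (l - 2 * (a + t).+1) = l - 2 * (a + t).+1.
  by move: La tL; clear; lia.
move=> h2; have {}h1 : a.+1 ^ 2 + t * (l - 2 * a) <= m + t ^ 2.
  by apply: h1; move: tL; clear; lia.
have e : (l - 2 * (a + t).+1).+1 + 2 * t + 1 = l - 2 * a by move: tL; clear; lia.
rewrite mulSn; have -> : t.+1 ^ 2 = t ^ 2 + 2 * t + 1 by clear; lia.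
move: e h1 h2; move: (l - 2 * a) (l - 2 * (a + t).+1) => c w e.
by move: (t * c) (t ^ 2) (a.+1 ^ 2) => x y z; move: e; clear; lia.
Qed.

(** The layers add up to about [L ^ 2 / 8], more than the required ninth, so only lower order terms
    matter. For [L = 5] the estimate is an equality, 54 on both sides; for [L = 3] the layers would
    give only 27 against 34. *)
Lemma boundary_lt_faces : 4 <= L -> L.+1 ^ 2 + 18 <= 9 * nfaces alpha sigma.
Proof.
move=> L4; have nf r : #|ball_faces r| <= nfaces alpha sigma.
  by apply/subset_leq_card/subsetP => H; rewrite inE => /andP [].
set a := L %/ 4; have [La aL] : L < 4 * a.+1 /\ 4 * a <= L.
  by rewrite /a; move: (cut _ _) => l; clear; lia.
have := @card_ball_faces_high a (L %/ 2 - a) La aL.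
have -> : a + (L %/ 2 - a) = L %/ 2 by move: La aL; move: (cut _ _) => l; clear; lia.
have {nf} := nf (L %/ 2).
move: La aL L4; move: a (cut _ _) #|_| (nfaces _ _) => a l m f La aL L4 nf h.
have {h} h : a.+1 ^ 2 + (l %/ 2 - a) * (l - 2 * a) <= f + (l %/ 2 - a) ^ 2.
  by apply: leq_trans (h _) _; [clear; lia | rewrite leq_add2r].
have : [\/ l = 4 * a, l = 4 * a + 1, l = 4 * a + 2 | l = 4 * a + 3].
  have : l = 4 * a \/ l = 4 * a + 1 \/ l = 4 * a + 2 \/ l = 4 * a + 3.
    by move: La aL; clear; lia.
  by case=> [|[|[]]]; [constructor 1 | constructor 2 | constructor 3 | constructor 4].
have a1 : 0 < a by move: La L4; clear; lia.
case=> e; move: h.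
- have [-> ->] : l %/ 2 - a = a /\ l - 2 * a = 2 * a by rewrite e; clear; lia.
  by rewrite e; move: a1; clear; nia.
- have [-> ->] : l %/ 2 - a = a /\ l - 2 * a = 2 * a + 1 by rewrite e; clear; lia.
  by rewrite e; move: a1; clear; nia.
- have [-> ->] : l %/ 2 - a = a.+1 /\ l - 2 * a = 2 * a + 2 by rewrite e; clear; lia.
  by rewrite e; move: a1; clear; nia.
- have [-> ->] : l %/ 2 - a = a.+1 /\ l - 2 * a = 2 * a + 3 by rewrite e; clear; lia.
  by rewrite e; move: a1; clear; nia.
Qed.

End CountFaces.

(** * A minimal unbalanced bond *)

Section MinimalBond.
Hypothesis cubic_sigma : cubic sigma.
Hypothesis large : 12 <= #|D|.

Lemma cut_set0l B : cut set0 B = 0.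
Proof. by apply/eqP/cut_eq0P => d; rewrite inE. Qed.

Lemma conn_porbit d : conn (porbit sigma d).
Proof.
apply/connP => K /vsetP vK sK _; have [-> | [e eK]] := set_0Vmem K; first by left.
right; apply/eqP; rewrite eqEsubset sK.
have /porbit_eqP <- := subsetP sK e eK.
apply/subsetP => _ /porbitP [i ->]; elim: i => [|i IH]; first by rewrite expg0 perm1.
by rewrite expgSr permM vK.
Qed.

Lemma cut_leq_card V K : cut V K <= #|V|.
Proof. by apply/subset_leq_card/subsetP => d; rewrite inE => /andP []. Qed.

Lemma conn_cut_gt0 A K : conn A -> vset K -> K \subset A -> K != set0 -> K != A ->
  0 < cut K (A :\: K).
Proof.
move=> /connP cA vK sK K0 KA; rewrite lt0n; apply/eqP => c0.
by case: (cA K vK sK c0) => e; rewrite e eqxx in K0 KA.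
Qed.

(* K is the complement of a vertex that is not a cut vertex. *)
Lemma cocard3_bond :
  exists2 K, bond K & #|D| = #|K| + 3 /\ cut K (~: K) <= 3.
Proof.
pose P (K : {set D}) := [&& vset K, conn K & K != setT].
(* Take a maximal connected proper vertex set: adding an adjacent vertex must give everything. *)
have [K /maxsetP [/and3P [vK cK KT] maxK] _] : {K | maxset P K & set0 \subset K}.
  apply: maxset_exists; rewrite /P vset0 conn0 /=; apply/eqP => e.
  by move: large; rewrite -cardsT -e cards0.
have big e : porbit sigma e != setT.
  apply/eqP => pT; have := cubic_sigma e; rewrite pT cardsT => D3.
  by move: large; rewrite D3.
have K0 : K != set0.
  apply/eqP => K0; have [d _] : exists d : D, d \in D by apply/card_gt0P; apply: leq_trans large.
  have /setP /(_ d) : porbit sigma d = K.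
    by apply: maxK; rewrite ?K0 ?sub0set // /P vset_porbit conn_porbit big.
  by rewrite porbit_id K0 inE.
have /cut_gt0P [d dK] := conn_cut_gt0 connT vK (subsetT _) K0 KT.
rewrite !inE andbT => aK; set V := porbit sigma (alpha d).
have vV : vset V by apply: vset_porbit.
have KV : K :|: V = setT.
  apply/eqP/negPn/negP => nT; have KVK : K :|: V = K.
    apply: maxK; last exact: subsetUl.
    rewrite /P vsetU // nT andbT /=; apply: connU; rewrite ?conn_porbit //.
    by apply/cut_gt0P; exists d; rewrite ?porbit_id.
  by move: aK; rewrite -KVK !inE porbit_id orbT.
have CK : ~: K = V.
  apply/setP => e; rewrite inE; apply/idP/idP => [eK | eV].
    by have /setP/(_ e) := KV; rewrite !inE (negPf eK).
  apply: contra aK => eK; move: eV; rewrite /V porbit_sym => /porbitP [i ->].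
  elim: i => [|i IH]; first by rewrite expg0 perm1.
  by rewrite expgSr permM (vsetP _ vK).
exists K; first by rewrite /bond vK cK CK conn_porbit.
rewrite -(cardsC K) CK cubic_sigma; split=> //.
by rewrite cutC; apply: leq_trans (cut_leq_card _ _) _; rewrite cubic_sigma.
Qed.

Section Full.
Variables (L : nat) (A : {set D}).
Hypothesis L3 : 3 <= L.
Hypothesis bA : bond A.
Hypothesis small : forall K, bond K -> K \proper A -> cut K (~: K) <= L ->
  3 * (#|K| + cut K (~: K)) < #|D|.
Hypothesis unbalanced : forall K, bond K -> cut K (~: K) <= L ->
  #|D| <= 3 * (#|K| + cut K (~: K)) -> 2 * #|D| < 3 * (#|K| + cut K (~: K)).
Hypothesis heavy : 2 * #|D| < 3 * (#|A| + cut A (~: A)).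
Local Notation B := (~: A).

Let vA : vset A. Proof. by case/and3P: bA. Qed.
Let cA : conn A. Proof. by case/and3P: bA. Qed.
Let cB : conn B. Proof. by case/and3P: bA. Qed.
Let vB : vset B. Proof. exact: vsetC. Qed.

(* V is a vertex on the boundary of A whose removal leaves the two branches K
   and K'; moving V to one of them gives a partition of A into two short bonds,
   unless both branches hang on bridges. *)
Section CutVertex.
Variables V K : {set D}.
Local Notation K' := ((A :\: V) :\: K).
Hypotheses (vV : vset V) (cV : conn V) (cardV : #|V| = 3) (sV : V \subset A).
Hypotheses (vK : vset K) (sK : K \subset A :\: V) (cK : conn K) (cK' : conn K').
Hypotheses (VK : cut V K = 1) (VK' : cut V K' = 1) (VB : cut V B = 1).
Hypothesis KK' : cut K K' = 0.
Hypothesis short : cut A B < L.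

Let cardA : #|A| = 3 + (#|K| + #|K'|).
Proof.
by rewrite -(cardsID V A) (setIidPr sV) cardV -(cardsID K (A :\: V)) (setIidPr sK).
Qed.

Let cutA : cut A B = 1 + (cut K B + cut K' B).
Proof. by rewrite (cutDl _ sV) VB (cutDl _ sK). Qed.

Let pointwise d : ((d \in V) ==> (d \in A)) && ((d \in K) ==> (d \in A) && (d \notin V)).
Proof.
apply/andP; split; apply/implyP; first exact: subsetP.
by move/(subsetP sK); rewrite inE andbC.
Qed.

Let vK' : vset K'. Proof. by rewrite !vsetD. Qed.

Lemma bond_branch : bond K' /\ cut K' (~: K') = cut K' B + 1.
Proof.
have C : ~: K' = (B :|: V) :|: K.
  apply/setP => d; rewrite !inE; have := pointwise d.
  by case: (d \in A); case: (d \in V); case: (d \in K).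
have dis1 : [disjoint B :|: V & K].
  rewrite disjoints_subset; apply/subsetP => d; rewrite !inE; have := pointwise d.
  by case: (d \in A); case: (d \in V); case: (d \in K).
have dis2 : [disjoint B & V].
  rewrite disjoints_subset; apply/subsetP => d; rewrite !inE; have := pointwise d.
  by case: (d \in A); case: (d \in V).
split; last first.
  by rewrite C (cutUr _ dis1) (cutUr _ dis2) (cutC K' K) KK' addn0 (cutC K' V) VK'.
rewrite /bond vK' cK' C connU ?vsetU //; first by apply: connU; rewrite // cutC VB.
by rewrite cutUl // VK addn1.
Qed.

(** The bonds of [K'] and [K :|: V] are both short; for the latter, the edge from [K'] to [B] makes
    up for the extra edge at [V]. Both sets are light, but their sizes exceed that of [A] by 2 in
    total. *)
Lemma no_cut_vertex_pos : 0 < cut K' B -> False.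
Proof.
move=> p'; have [bK' dK'] := bond_branch.
have C : ~: (K :|: V) = B :|: K'.
  apply/setP => d; rewrite !inE; have := pointwise d.
  by case: (d \in A); case: (d \in V); case: (d \in K).
have dis1 : [disjoint B & K'].
  rewrite disjoints_subset; apply/subsetP => d; rewrite !inE; have := pointwise d.
  by case: (d \in A); case: (d \in V); case: (d \in K).
have dis2 : [disjoint K & V].
  rewrite disjoints_subset; apply/subsetP => d; rewrite !inE; have := pointwise d.
  by case: (d \in A); case: (d \in V); case: (d \in K).
have bKV : bond (K :|: V).
  rewrite /bond vsetU // C connU ?(cutC K V) ?VK //=.
  by apply: connU; rewrite // cutC.
have dKV : cut (K :|: V) (~: (K :|: V)) = cut K B + 2.
  by rewrite C cutUl // !(cutUr _ dis1) KK' VB VK' addn0.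
have cKV : #|K :|: V| = #|K| + 3.
  by rewrite -cardV; apply/eqP; rewrite (leq_card_setU K V).2.
have pK' : K' \proper A.
  apply/properP; split; first by rewrite (subset_trans (subsetDl _ _)) ?subsetDl.
  have /cut_gt0P [d dV _] : 0 < cut V B by rewrite VB.
  by exists d; rewrite ?(subsetP sV) // !inE dV andbF.
have pKV : K :|: V \proper A.
  apply/properP; split; first by rewrite subUset sV (subset_trans sK) ?subsetDl.
  have /cut_gt0P [d dinK' _] := p'; exists d; last first.
    by move: dinK'; rewrite !inE => /and3P [/negPf -> /negPf ->].
  by move: dinK'; rewrite !inE => /and3P [].
have := small bK' pK'; have := small bKV pKV.
move: heavy short; rewrite dK' dKV cKV cutA cardA.
move: p'; move: (cut K B) (cut K' B) #|K| #|K'| #|D| L => p q k k' n l; clear.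
move=> p' hv sh h1 h2.
have := h1 ltac:(lia); have := h2 ltac:(lia); lia.
Qed.

End CutVertex.

(** In the remaining case all three edges at [V] are bridges. As [K] and [K'] are light, [B] meets
    at least a third of the edges, hence more than two thirds by [unbalanced]. So does [A], though
    they share a single edge. *)
Lemma no_cut_vertex V K : vset V -> conn V -> #|V| = 3 -> V \subset A ->
  vset K -> K \subset A :\: V -> conn K -> conn (A :\: V :\: K) ->
  cut V K = 1 -> cut V (A :\: V :\: K) = 1 -> cut V B = 1 ->
  cut K (A :\: V :\: K) = 0 -> cut A B < L -> False.
Proof.
move=> vV cV c3 sV vK sK cK; set K' := A :\: V :\: K => cK' VK VK' VB KK' short.
have sK' : K' \subset A :\: V by apply: subsetDl.
have vK' : vset K' by rewrite !vsetD.
have KE : A :\: V :\: K' = K by apply: setDDK.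
have p'0 : cut K' B = 0.
  by case: (posnP (cut K' B)) => // /no_cut_vertex_pos; case.
have p0 : cut K B = 0.
  case: (posnP (cut K B)) => // p.
  by have := @no_cut_vertex_pos V K'; rewrite KE; case=> //; rewrite cutC.
have [bK' dK'] := bond_branch vV cV sV vK sK cK cK' VK VK' VB KK'.
have [bK dK] : bond K /\ cut K (~: K) = cut K B + 1.
  by have := @bond_branch V K'; rewrite KE; apply=> //; rewrite cutC.
have cutA : cut A B = 1 by rewrite (cutDl _ sV) VB (cutDl _ sK) -/K' p0 p'0.
have cardA : #|A| = 3 + (#|K| + #|K'|).
  by rewrite -(cardsID V A) (setIidPr sV) c3 -(cardsID K (A :\: V)) (setIidPr sK).
have Vsmall (E : {set D}) : E \subset A :\: V -> E \proper A.
  move=> sE; apply/properP; split; first by rewrite (subset_trans sE) ?subsetDl.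
  have /cut_gt0P [d dV _] : 0 < cut V B by rewrite VB.
  exists d; rewrite ?(subsetP sV) //; apply/negP => /(subsetP sE).
  by rewrite inE dV.
have bB : bond B by rewrite /bond vB cB setCK cA.
have := unbalanced bB; rewrite setCK (cutC B A) cutA.
have := small bK (Vsmall _ sK); have := small bK' (Vsmall _ sK').
move: heavy short large (cardsC A); rewrite dK dK' p0 p'0 cutA cardA.
move: #|K| #|K'| #|D| #|B| L => k k' n m l; clear => hv sh lg cB h1 h2 h3.
have := h1 ltac:(lia); have := h2 ltac:(lia); have := h3 ltac:(lia) ltac:(lia); lia.
Qed.

(** Delete a boundary vertex [V] from [A]. If the rest is connected, at most two new cut edges
    replace at least one old edge, so the boundary still fits in [L]; the tripled size falls by at
    most 12, which is at most [#|D|], so the rest is not light. Otherwise [V] has one edge to each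
    of two branches and one to [B]. *)
Lemma full_boundary : cut A B <= L -> cut A B = L.
Proof.
rewrite leq_eqVlt => /predU1P [// | short]; exfalso.
have [AT | AT] := eqVneq A setT.
  have [K bK [cD cK]] := cocard3_bond.
  have pK : K \proper A.
    rewrite AT properT; apply/eqP => KT; move: cD; rewrite KT cardsT.
    by clear; lia.
  have := small bK pK (leq_trans cK L3).
  by move: large cD; move: #|D| #|K| (cut _ _) => n k c; clear; lia.
have A0 : A != set0.
  by apply/eqP => A0; move: heavy; rewrite A0 cut_set0l cards0.
have /cut_gt0P [d dA] := conn_cut_gt0 connT vA (subsetT _) A0 AT.
rewrite !inE andbT => aA; set V := porbit sigma d.
have vV : vset V by apply: vset_porbit.
have cV : conn V by apply: conn_porbit.
have c3 : #|V| = 3 by apply: cubic_sigma.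
have sV : V \subset A.
  apply/subsetP => e /porbitP [i ->]; elim: i => [|i IH]; first by rewrite expg0 perm1.
  by rewrite expgSr permM (vsetP _ vA).
have q : 0 < cut V B by apply/cut_gt0P; exists d; rewrite ?porbit_id ?inE.
have disBA : [disjoint B & A :\: V].
  by rewrite disjoints_subset; apply/subsetP => e; rewrite !inE => /negPf ->; rewrite andbF.
have sum3 : cut V B + cut V (A :\: V) <= 3.
  by rewrite -(cutUr _ disBA) -c3 cut_leq_card.
have cardA : #|A| = 3 + #|A :\: V| by rewrite -(cardsID V A) (setIidPr sV) c3.
have cutA : cut A B = cut V B + cut (A :\: V) B by apply: cutDl.
have vA' : vset (A :\: V) by rewrite vsetD.
have [A'0 | A'0] := eqVneq (A :\: V) set0.
  move: heavy large; rewrite cutA cardA A'0 cards0 cut_set0l.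
  by move: sum3; move: (cut V B) (cut V _) #|D| => x y n; clear; lia.
have pos (E : {set D}) : vset E -> E \subset A :\: V -> E != set0 -> 0 < cut E (A :\: E).
  move=> vE sE E0; apply: conn_cut_gt0 => //; first by rewrite (subset_trans sE) ?subsetDl.
  apply/eqP => EA; have := subsetP sE d; rewrite EA dA !inE porbit_id /=.
  by move/(_ isT).
have [cA' | ncA'] := boolP (conn (A :\: V)).
  have C : ~: (A :\: V) = V :|: B.
    apply/setP => e; rewrite !inE negb_and negbK.
    by have /implyP := subsetP sV e; case: (e \in V).
  have disVB : [disjoint V & B] by rewrite disjoints_subset setCK.
  have bA' : bond (A :\: V) by rewrite /bond vA' cA' C connU.
  have dA' : cut (A :\: V) (~: (A :\: V)) = cut V (A :\: V) + cut (A :\: V) B.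
    by rewrite C (cutUr _ disVB) (cutC _ V).
  have pA' : A :\: V \proper A.
    by apply/properP; split; [exact: subsetDl | exists d; rewrite ?inE ?porbit_id].
  have := pos _ vA' (subxx _) A'0; rewrite (setDDK sV) cutC => dpos.
  have := small bA' pA'; move: heavy short large; rewrite dA' cutA cardA.
  move: q sum3 dpos; move: (cut V B) (cut V _) (cut (A :\: V) B) #|D| #|A :\: V| L.
  move=> x y z n k l; clear => q sum3 dpos hv sh lg h.
  by have := h ltac:(lia); lia.
have [K [vK sK KK' K0 KA']] : exists K : {set D}, [/\ vset K, K \subset A :\: V,
    cut K (A :\: V :\: K) = 0, K != set0 & K != A :\: V].
  move: ncA'; rewrite negb_forall => /existsP [K]; rewrite negb_imply negb_or.
  by move=> /andP [/andP [/andP [vK sK] /eqP KK'] /andP [K0 KA']]; exists K.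
set K' := A :\: V :\: K in KK' *.
have sK' : K' \subset A :\: V by apply: subsetDl.
have vK' : vset K' by rewrite vsetD.
have K'0 : K' != set0.
  by rewrite setD_eq0; apply: contra KA' => h; rewrite eqEsubset sK.
have split2 (E : {set D}) : E \subset A :\: V -> cut E (A :\: V :\: E) = 0 ->
    cut E (A :\: E) = cut V E.
  move=> sE E0; have -> : A :\: E = V :|: (A :\: V :\: E).
    apply/setP => e; rewrite !inE; have /implyP := subsetP sE e.
    have /implyP := subsetP sV e; rewrite !inE.
    by case: (e \in V); case: (e \in E); case: (e \in A).
  rewrite cutUr ?E0 ?addn0 1?cutC // disjoints_subset.
  by apply/subsetP => e eV; rewrite !inE eV andbF.
have VK : 0 < cut V K by rewrite -split2 ?pos.
have VK' : 0 < cut V K'.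
  by rewrite -split2 ?pos // (setDDK sK) cutC.
have sumK : cut V (A :\: V) = cut V K + cut V K' by apply: (cutDr).
have K'K : cut K' (A :\: V :\: K') = 0 by rewrite (setDDK sK) cutC.
have [e1 [e2 e3]] : cut V B = 1 /\ cut V K = 1 /\ cut V K' = 1.
  move: q sum3 VK VK'; rewrite sumK.
  by move: (cut V B) (cut V K) (cut V K') => x y z; clear; lia.
(* As [A] is connected, each component of a branch has its own edge to [V], and there is only
   one. *)
have connE (E : {set D}) : vset E -> E \subset A :\: V -> cut E (A :\: V :\: E) = 0 ->
    cut V E = 1 -> conn E.
  move=> vE sE E0 VE; apply/connP => J vJ sJ J0.
  have [-> | JN] := eqVneq J set0; first by left.
  have [-> | JE] := eqVneq J E; first by right.
  have J'N : E :\: J != set0.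
    by rewrite setD_eq0; apply: contra JE => h; rewrite eqEsubset sJ.
  have zero (G : {set D}) : G \subset E -> cut G (E :\: G) = 0 -> cut G (A :\: V :\: G) = 0.
    move=> sG G0; apply/eqP/cut_eq0P => x xG; apply/negP.
    rewrite !inE => /and3P [nG nV xA].
    have /eqP/cut_eq0P/(_ x (subsetP sG x xG)) := E0.
    rewrite !inE nV xA !andbT negbK => aE.
    by have /eqP/cut_eq0P/(_ x xG) := G0; rewrite !inE nG aE.
  have VJ : 0 < cut V J.
    have sJA := subset_trans sJ sE.
    by rewrite -split2 ?pos // zero.
  have VJ' : 0 < cut V (E :\: J).
    have sJ' : E :\: J \subset E := subsetDl _ _.
    have sJA' := subset_trans sJ' sE.
    by rewrite -split2 ?pos ?vsetD // zero // setDDK // cutC.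
  by move: VE VJ VJ'; rewrite (cutDr V sJ); move: (cut V J) (cut V _) => x y; clear; lia.
exact: (no_cut_vertex vV cV c3 sV vK sK (connE _ vK sK KK' e2)
  (connE _ vK' sK' K'K e3) e2 e3 e1 KK' short).
Qed.

End Full.

Lemma sigma_cube d : sigma (sigma (sigma d)) = d.
Proof. by have := iter_porbit sigma d; rewrite cubic_sigma. Qed.

Lemma balanced_bond L : 4 <= L -> 9 * nfaces alpha sigma < L.+1 ^ 2 + 18 ->
  exists A, [/\ bond A, cut A (~: A) <= L, #|D| <= 3 * (#|A| + cut A (~: A)) &
                3 * (#|A| + cut A (~: A)) <= 2 * #|D|].
Proof.
move=> L4 few; pose size3 A := 3 * (#|A| + cut A (~: A)).
pose good A := [&& bond A, cut A (~: A) <= L & #|D| <= size3 A].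
have [/existsP [A /and4P [*]] | none] :=
  boolP [exists A : {set D}, [&& bond A, cut A (~: A) <= L, #|D| <= size3 A & size3 A <= 2 * #|D|]].
  by exists A.
have unbalanced K : bond K -> cut K (~: K) <= L -> #|D| <= size3 K -> 2 * #|D| < size3 K.
  move=> bK cK sK; rewrite ltnNge; apply: contra none => sK'.
  by apply/existsP; exists K; rewrite bK cK sK.
(* The whole vertex set, with empty boundary, starts the minimization. *)
have goodT : good setT.
  by rewrite /good /bond /size3 vsetT setCT connT conn0 cutC cut_set0l cardsT addn0 leq_pmull.
case: (arg_minnP (fun A : {set D} => #|A|) goodT) => A /and3P [bA cA sA] minA.
have heavy := unbalanced A bA cA sA.
have small K : bond K -> K \proper A -> cut K (~: K) <= L -> size3 K < #|D|.
  move=> bK pK cK; rewrite ltnNge; apply/negP => sK.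
  have := minA K; rewrite /good bK cK sK => /(_ isT).
  by rewrite leqNgt proper_card.
have cE := full_boundary (leq_trans (leqnSn 3) L4) bA small unbalanced heavy cA.
have tightA := tight bA small heavy cA.
have /card_gt0P [x0 x0X] : 0 < #|exits A| by rewrite card_exits cE; apply: leq_trans L4.
have := boundary_lt_faces sigma_cube bA tightA x0X.
by rewrite cE => /(_ L4); rewrite leqNgt few.
Qed.

End MinimalBond.

(** * The noose of a bond *)

Section Noose.
Hypothesis cubic_sigma : cubic sigma.
Let sigma3 := sigma_cube cubic_sigma.

Lemma cubic_porbitP d e : e \in porbit sigma d ->
  [\/ e = d, e = sigma d | e = sigma (sigma d)].
Proof.
case/porbitP => i ->; elim: i => [|i [] IH]; first by rewrite expg0 perm1; constructor 1.
- by rewrite expgSr permM IH; constructor 2.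
- by rewrite expgSr permM IH; constructor 3.
- by rewrite expgSr permM IH sigma3; constructor 1.
Qed.

Lemma cubic_orbit d : fingraph.orbit sigma d = [:: d; sigma d; sigma (sigma d)].
Proof.
rewrite /fingraph.orbit; suff -> : fingraph.order sigma d = 3 by [].
rewrite -(cubic_sigma d); apply: eq_card => e; apply/idP/idP.
  by move/iter_findex <-; rewrite -permX mem_porbit.
by case/porbitP => i ->; rewrite permX; apply: fconnect_iter.
Qed.

Lemma cubic_neq d : [/\ sigma d != d, sigma (sigma d) != d & sigma d != sigma (sigma d)].
Proof.
have := fingraph.orbit_uniq sigma d; rewrite cubic_orbit /= !inE negb_or andbT.
by case/andP => /andP [n1 n2] n3; split; rewrite // eq_sym.
Qed.

Variable A : {set D}.
Hypothesis bA : bond A.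
Hypothesis inner : exists2 d, d \in A & alpha d \in A.
Local Notation next := (next_exit A).

Let vA d : (sigma d \in A) = (d \in A).
Proof. by case/and3P: bA => /vsetP. Qed.

(** Such a vertex would be a component of [A], hence all of [A], against [inner]. *)
Lemma vertex_not_all_exits d :
  ~~ [&& d \in exits A, sigma d \in exits A & sigma (sigma d) \in exits A].
Proof.
apply/negP => /and3P [e1 e2 e3]; have /and3P [vA' cA _] := bA.
have all e : e \in porbit sigma d -> e \in exits A by case/cubic_porbitP => ->.
have sV : porbit sigma d \subset A.
  by apply/subsetP => e /all; rewrite inE => /andP [].
have c0 : cut (porbit sigma d) (A :\: porbit sigma d) = 0.
  apply/eqP/cut_eq0P => e /all; rewrite !inE => /andP [_ /negPf ->].
  by rewrite andbF.
case: (connP _ cA _ (vset_porbit _) sV c0) => e.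
  by have := porbit_id sigma d; rewrite e inE.
have [x xA axA] := inner; rewrite -e in xA; have := all _ xA.
by rewrite inE axA andbF.
Qed.

(* A vertex of A may carry two consecutive exits; the noose passes it once,
   entering after the run of exits and leaving before it. *)
Definition run_starts := [set x in exits A | sigma (sigma x) \notin exits A].

Definition after_run x := if sigma x \in exits A then sigma (sigma x) else sigma x.

Definition next_run x :=
  if sigma (sigma (next x)) \in exits A then sigma (sigma (next x)) else next x.

Lemma mem_run_starts x :
  (x \in run_starts) = (x \in exits A) && (sigma (sigma x) \notin exits A).
Proof. exact: in_set. Qed.

Lemma run_starts_exits x : x \in run_starts -> x \in exits A.
Proof. by rewrite mem_run_starts => /andP []. Qed.

Lemma run_start_vertex e : e \in exits A -> exists2 s, s \in run_starts & e \in porbit sigma s.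
Proof.
move=> eX; case e2 : (sigma (sigma e) \in exits A).
  exists (sigma (sigma e)); last first.
    by rewrite porbit_sym -permM; apply: (mem_porbit sigma 2 e).
  have := vertex_not_all_exits e; rewrite mem_run_starts e2 eX /= andbT.
  by rewrite sigma3.
by exists e; rewrite ?porbit_id // mem_run_starts eX e2.
Qed.

(** The dart [sigma (next x)] lies in the face of [x], so as an exit it would be [x], and [x] would
    not start its run. Thus [next x] is the last exit of its run in rotation order. *)
Lemma next_notin_run x : x \in run_starts -> sigma (next x) \notin exits A.
Proof.
move=> xS; have xX := run_starts_exits xS; apply/negP => sX.
have h : sigma (next x) \in porbit phi x.
  have := next_face bA xX; move/porbit_eqP => <-.
  by have := mem_porbit phi 1 (alpha (next x)); rewrite expg1 face_permE alphaK.
have e := exit_face_inj bA xX sX h.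
by move: xS; rewrite mem_run_starts -e sigma3 next_in // andbF.
Qed.

Lemma after_next_run x : x \in run_starts -> after_run (next_run x) = sigma (next x).
Proof.
move=> xS; rewrite /after_run /next_run.
case: (sigma (sigma (next x)) \in exits A); last by rewrite (negPf (next_notin_run xS)).
by rewrite sigma3 next_in ?run_starts_exits.
Qed.

Lemma next_run_in x : x \in run_starts -> next_run x \in run_starts.
Proof.
move=> xS; rewrite /next_run; case: ifP => h; rewrite mem_run_starts; first by rewrite h sigma3 next_notin_run.
by rewrite h next_in ?run_starts_exits.
Qed.

Lemma next_run_inj : {in run_starts &, injective next_run}.
Proof.
move=> x y xS yS e; apply: (next_inj bA); rewrite ?run_starts_exits //.
by apply: (@perm_inj _ sigma); rewrite -!after_next_run // e.
Qed.

Lemma after_run_face x : x \in run_starts ->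
  porbit phi (after_run (next_run x)) = porbit phi x.
Proof.
move=> xS; rewrite after_next_run //; apply/porbit_eqP.
have := next_face bA (run_starts_exits xS); move/porbit_eqP => <-.
by have := mem_porbit phi 1 (alpha (next x)); rewrite expg1 face_permE alphaK.
Qed.

Lemma after_run_vertex x : porbit sigma (after_run x) = porbit sigma x.
Proof.
rewrite /after_run; case: ifP => _; last exact: (porbit_perm sigma 1).
by rewrite -permM; apply: (porbit_perm sigma 2).
Qed.

Lemma run_start_unique x y : x \in run_starts -> y \in run_starts ->
  porbit sigma x = porbit sigma y -> x = y.
Proof.
rewrite !mem_run_starts => /andP [xX nx] /andP [yX ny] /esym/porbit_eqP.
case/cubic_porbitP => e //; first by rewrite e sigma3 xX in ny.
by rewrite -e yX in nx.
Qed.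

Let orbit_run x0 := fingraph.orbit next_run x0.

Lemma orbit_run_in x0 x : x0 \in run_starts -> x \in orbit_run x0 -> x \in run_starts.
Proof.
move=> x0S; rewrite -fconnect_orbit => /iter_findex <-.
by elim: (findex _ _ _) => //= n; apply: next_run_in.
Qed.

(** A run has at most two exits, and [next] traverses it backwards. So the visited starts and their
    images under [next] form a closed set of exits, which is all of them. *)
Lemma mem_orbit_run x0 w : x0 \in run_starts -> w \in run_starts -> w \in orbit_run x0.
Proof.
move=> x0S; pose O := [set x in orbit_run x0].
have OS x : x \in O -> x \in run_starts by rewrite inE; apply: orbit_run_in.
have Onext x : x \in O -> next_run x \in O.
  by rewrite !inE -!fconnect_orbit => c; apply: connect_trans c (fconnect1 _ _).
have [|||YE _] := closed_exits (Y := O :|: next @: O) bA.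
- by apply/set0Pn; exists x0; rewrite !inE -fconnect_orbit connect0.
- apply/subsetP => x; rewrite in_setU => /orP [/OS /run_starts_exits // | /imsetP [y /OS yS ->]].
  by rewrite next_in ?run_starts_exits.
- move=> x; rewrite !in_setU => /orP [xO | /imsetP [y yO ->]]; first by rewrite imset_f ?orbT.
  have yX := run_starts_exits (OS _ yO); have zX := next_in bA yX.
  have := Onext _ yO; rewrite /next_run; case: ifP => h wO; last by rewrite imset_f ?orbT.
  suff -> : next (next y) = sigma (sigma (next y)) by rewrite wO.
  set z := next y in zX h wO *; set w' := sigma (sigma z) in h wO *.
  have Lgt0 : 0 < cut A (~: A) by rewrite -card_exits; apply/card_gt0P; exists z.
  have wE : w' = next (iter (cut A (~: A)).-1 next w').
    by rewrite -iterS prednK // iter_next_period.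
  have vX := iter_next_in bA (cut A (~: A)).-1 h.
  rewrite [RHS]wE; congr next_exit; apply: (exit_face_inj bA) => //.
  have := next_face bA vX; rewrite -wE => /porbit_eqP <-.
  by have := mem_porbit phi 1 (alpha w'); rewrite expg1 face_permE alphaK /w' sigma3.
move=> wS; have := run_starts_exits wS; rewrite -YE in_setU => /orP [|/imsetP [x xO wx]].
  by rewrite inE.
have := Onext _ xO; rewrite /next_run -wx.
by move: wS; rewrite mem_run_starts => /andP [_ /negPf ->]; rewrite inE.
Qed.

Lemma arc_run s : Defs.arc sigma (after_run s) s =
  if sigma s \in exits A then [:: sigma (sigma s)] else [:: sigma s; sigma (sigma s)].
Proof.
have [n1 n2 _] := cubic_neq s; rewrite /Defs.arc /after_run.
by case: (sigma s \in exits A); rewrite cubic_orbit !sigma3 /= (negPf n1) ?(negPf n2) eqxx.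
Qed.

Lemma mem_arc_run s y : s \in run_starts -> y \in porbit sigma s ->
  (y \in Defs.arc sigma (after_run s) s) = (y \notin exits A).
Proof.
rewrite mem_run_starts => /andP [sX s2]; have [n1 n2 n3] := cubic_neq s.
rewrite arc_run => /cubic_porbitP.
case=> ->; case h : (sigma s \in exits A); rewrite !in_cons in_nil orbF ?sX ?h ?s2 ?eqxx ?orbT //.
- by rewrite eq_sym (negPf n2).
- by rewrite !(eq_sym s) (negPf n1) (negPf n2).
- by rewrite (negPf n3).
Qed.

Lemma bond_noose : exits A != set0 ->
  exists k (a b : 'I_k -> D), [/\ is_noose alpha sigma a b,
    enclosed_darts alpha sigma a b [set d in A | alpha d \in A] & k <= cut A (~: A)].
Proof.
case/set0Pn => e0 /run_start_vertex [x0 x0S _].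
pose k := fingraph.order next_run x0; pose x i := iter i next_run x0.
have xS i : x i \in run_starts by rewrite /x; elim: i => //= n; apply: next_run_in.
have xX i := run_starts_exits (xS i).
have xinj (i j : 'I_k) : x i = x j -> i = j.
  move=> e; apply/val_inj/eqP; rewrite /= -(nth_uniq x0 _ _ (fingraph.orbit_uniq next_run x0))
    ?fingraph.size_orbit ?ltn_ord //.
  by rewrite /fingraph.orbit !nth_traject ?ltn_ord // -/(x _) -/(x _) e.
have xS1 (i : 'I_k) : x (ordS i) = next_run (x i).
  rewrite /= -[RHS]/(x i.+1); have := ltn_ord i; rewrite leq_eqVlt => /predU1P [-> | ik].
    by rewrite modnn /x /k (iter_order_in next_run_in next_run_inj).
  by rewrite modn_small.
exists k, (fun i => after_run (x i)), (fun i => x i); split.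
- split; first exact: fingraph.order_gt0.
  split; first by move=> i; rewrite after_run_vertex porbit_id.
  split; first by move=> i j; rewrite !after_run_vertex => /run_start_unique h; apply/xinj/h.
  split; first by move=> i; rewrite xS1 after_run_face.
  by move=> i j /porbit_eqP h; apply/xinj/(exit_face_inj bA).
- split; first by move=> d; rewrite !inE alphaK andbC.
  split=> [i y | y out].
    rewrite after_run_vertex => yx; rewrite mem_arc_run // !inE.
    have -> : y \in A.
      have := run_starts_exits (xS i); rewrite inE => /andP [xA _].
      by case/cubic_porbitP: yx => ->; rewrite ?vA.
    by rewrite negbK.
  (* Every vertex with an exit is on the noose, so off the noose all darts of a vertex are on one
     side. *)
  have noX e : e \in porbit sigma y -> e \notin exits A.
    move=> ey; apply/negP => /run_start_vertex [s sS es].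
    have /trajectP [i ik si] := mem_orbit_run x0S sS.
    have /negP := out (Ordinal ik); apply; rewrite after_run_vertex /x /= -si.
    by move/porbit_eqP: ey => ey; apply/porbit_eqP; rewrite -ey; apply/porbit_eqP.
  have := noX (sigma y) (mem_porbit sigma 1 y); have := noX y (porbit_id _ _).
  by rewrite !inE vA; case: (y \in A) => //=; rewrite !negbK => -> ->.
- rewrite -card_exits; apply/subset_leq_card/subsetP => y.
  by rewrite [y \in _]fconnect_orbit => /(orbit_run_in x0S) /run_starts_exits.
Qed.

End Noose.

End SphericalMap.

(** * Choice of the length bound and edge counts *)

Lemma card_orbits (T : finType) (s : {perm T}) c (S : {set T}) :
  (forall d, #|porbit s d| = c) -> (forall d, (s d \in S) = (d \in S)) ->
  #|S| = c * #|[set porbit s d | d in S]|.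
Proof.
move=> cs vS; rewrite -sum1_card (partition_big (porbit s) (mem [set porbit s d | d in S])) /=;
  last by move=> d dS; apply: imset_f.
rewrite mulnC -sum_nat_const; apply: eq_bigr => _ /imsetP [e eS ->].
rewrite sum1_card -(cs e); apply: eq_card => d; rewrite unfold_in /= eq_porbit_mem.
case: (boolP (d \in porbit s e)); last by rewrite andbF.
case/porbitP => i ->; rewrite andbT.
by elim: i => [|i IH]; [rewrite expg0 perm1 | rewrite expgSr permM vS].
Qed.

Theorem theorem4p15 (D : finType) (alpha sigma : {perm D}) :
  spherical alpha sigma -> cubic sigma -> (6 <= nedges alpha)%N ->
  exists (k : nat) (a b : 'I_k -> D) (S : {set D}),
    is_noose alpha sigma a b /\ enclosed_darts alpha sigma a b S /\
    two_thirds_balanced alpha S /\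
    (* length k <= sqrt(4.5 n)  <=>  2 k^2 <= 9 n *)
    (2 * k ^ 2 <= 9 * nvertices sigma)%N.
Proof.
move=> [[invol connected] euler] cubic_sigma m6.
have alphaK d := (invol d).1; have alphaN d := (invol d).2.
have card_alpha d : #|porbit alpha d| = 2.
  by rewrite porbit_alpha // cards2 eq_sym alphaN.
have cardE (S : {set D}) : (forall d, (alpha d \in S) = (d \in S)) ->
  #|S| = 2 * edges_in alpha S by apply: card_orbits.
have cardT c (s : {perm D}) : (forall d, #|porbit s d| = c) -> #|D| = c * #|porbits s|.
  move=> cs; rewrite -cardsT (card_orbits (s := s) cs) => [|d]; last by rewrite !inE.
  by congr (_ * _); apply: eq_card => H; apply/imsetP/imsetP => -[d _ ->]; exists d.
have Dm : #|D| = 2 * nedges alpha := cardT _ _ card_alpha.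
have Dn : #|D| = 3 * nvertices sigma := cardT _ _ cubic_sigma.
have [L L2 maxL] : exists2 L, 2 * L ^ 2 <= 9 * nvertices sigma &
    9 * nvertices sigma < 2 * L.+1 ^ 2.
  have ex : exists L, 2 * L ^ 2 <= 9 * nvertices sigma by exists 0.
  have ub L : 2 * L ^ 2 <= 9 * nvertices sigma -> L <= 9 * nvertices sigma.
    by move: (nvertices sigma) => n; clear; nia.
  case: (ex_maxnP ex ub) => L hL mL; exists L => //.
  by rewrite ltnNge; apply/negP => /mL; rewrite ltnn.
have large : 12 <= #|D| by rewrite Dm; move: m6; clear; lia.
(* Six edges mean at least four vertices, and [2 * 4 ^ 2 <= 9 * 4]. *)
have L4 : 4 <= L.
  have n4 : 4 <= nvertices sigma by move: large; rewrite Dn; clear; lia.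
  by move: n4 maxL; move: (nvertices sigma) => n; clear; nia.
have few : 9 * nfaces alpha sigma < L.+1 ^ 2 + 18.
  move: euler maxL Dm Dn; move: (nvertices _) (nfaces _ _) (nedges _) #|D| (L.+1 ^ 2).
  by clear; lia.
have [A [bA cA loA hiA]] :=
  balanced_bond alphaK alphaN connected euler cubic_sigma large L4 few.
have /and3P [vA kA kB] := bA.
have bB : bond alpha sigma (~: A).
  by rewrite /bond vsetC // kB setCK kA.
(* The noose is pushed to the side of [B], so that the excluded edges are exactly those meeting [A],
   the number that [balanced_bond] controls. *)
set B := ~: A in bB cA loA hiA.
have cB : cut alpha B (~: B) = cut alpha A B by rewrite setCK cutC.
have cardAB : #|A| + #|B| = #|D| := cardsC A.
pose S := [set d in B | alpha d \in B].
have cardS : #|S| + cut alpha B (~: B) = #|B|.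
  by rewrite -card_exits -[RHS](cardsID [set d | alpha d \in B]); congr (_ + _);
     apply: eq_card => d; rewrite !inE // andbC.
(* At most two thirds of the edges meet [A], so some edge lies inside [B]. *)
have inner : exists2 d, d \in B & alpha d \in B.
  have /card_gt0P [d] : 0 < #|S|.
    move: large loA hiA cardAB cardS; rewrite cB.
    by move: #|D| #|A| #|B| #|S| (cut _ _ _) => n x y z c; clear; lia.
  by rewrite inE => /andP []; exists d.
have exB : exits alpha B != set0.
  have A0 : A != set0.
    by apply/eqP => A0; move: loA large; rewrite A0 cut_set0l cards0; case: #|D|.
  have AT : A != setT.
    apply/eqP => AT; move: hiA large; rewrite AT cardsT.
    by move: #|D| (cut _ _ _) => n c; clear; lia.
  have := conn_cut_gt0 (connT alphaK connected) vA (subsetT _) A0 AT.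
  by rewrite setTD -card_gt0 card_exits cB.
have [k [a [b [nab eab kle]]]] := bond_noose alphaK alphaN connected euler cubic_sigma bB inner exB.
exists k, a, b, S; split=> //; split=> //; split.
  have vS d : (alpha d \in S) = (d \in S) by rewrite !inE alphaK andbC.
  have vSC d : (alpha d \in ~: S) = (d \in ~: S) by rewrite in_setC vS in_setC.
  have eS := cardE _ vS; have eSC := cardE _ vSC; have cS := cardsC S.
  rewrite cB in cardS; rewrite Dm in cardAB loA hiA; rewrite Dm in cS.
  by split; clear -eS eSC cS cardS cardAB loA hiA; lia.
have kL : k <= L by apply: leq_trans kle _; rewrite cB.
by apply: leq_trans L2; rewrite leq_mul2l leq_exp2r.
Qed.
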